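(* Let $p>0$ and $h,\alpha\in\mathbb R$ satisfy $-\frac1p<h<\alpha<0$. Then there exists a one-periodic function $f$, with wavelet coefficient sequence $\vec c$, such that $\eta_f(p)>0$ and \[ \mathscr D_f^{(p)}(h)=\frac{(\rho_{\vec c}(\alpha)-1)h}{\alpha}+1>\left(h+\frac1p\right)\sup_{\alpha'\in(-\frac1p,h]}\frac{\rho_{\vec c}(\alpha')}{\alpha'+\frac1p}. \]
   Context: Conventions: $\mathbb N_0=\{0,1,2,\dots\}$; $\log_2 0=-\infty$; the Hausdorff dimension of the empty set is $-\infty$. Wavelets. Fix a mother wavelet $\psi$ in the Schwartz class such that the functions $2^{j/2}\psi_{j,k}$, $j\in\mathbb N_0$, $0\le k\le 2^j-1$, with $\psi_{j,k}(x)=\sum_{l\in\mathbb Z}\psi(2^j(x-l)-k)$, together with the constant function $1$, form an orthonormal basis of $L^2([0,1])$. A one-periodic function $f=\sum_{j,k}c_{j,k}\psi_{j,k}$ is identified with its coefficient sequence $\vec c=(c_{j,k})$ (the series need not converge in $L^2$). Dyadic intervals are $\lambda_{j,k}=[k2^{-j},(k+1)2^{-j})$; $\Lambda_j=\{\lambda_{j,k}:0\le k\le 2^j-1\}$; $c_{\lambda_{j,k}}=c_{j,k}$; $\lambda_j(x_0)$ is the interval of $\Lambda_j$ containing $x_0$ (modulo 1); $3\lambda_{j,k}$ is the union of $\lambda_{j,k-1},\lambda_{j,k},\lambda_{j,k+1}$ (modulo 1). Scaling function: $\eta_f(p)=\liminf_{j\to+\infty}-\frac1j\log_2\left(2^{-j}\sum_{k=0}^{2^j-1}|c_{j,k}|^p\right)$,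 $p>0$. Wavelet density: for $\alpha\in\mathbb R$, \[\rho_{\vec c}(\alpha)=\lim_{\varepsilon\to0^+}\limsup_{j\to+\infty}\frac1j\log_2\#\{k\in\{0,\dots,2^j-1\}:2^{-(\alpha+\varepsilon)j}\le|c_{j,k}|\le2^{-(\alpha-\varepsilon)j}\}.\] $p$-exponent. For $p\ge1$, $f\in L^p_{\mathrm{loc}}(\mathbb R)$, $\alpha\ge-\frac1p$, $x_0\in\mathbb R$: $f\in T^p_\alpha(x_0)$ if there exist $C>0$, a polynomial $P$ of degree less than $\alpha$ and $R>0$ with $\left(\frac1r\int_{B(x_0,r)}|f-P|^p\right)^{1/p}\le Cr^\alpha$ for all $0<r\le R$; $h^{(p)}_f(x_0)=\sup\{\alpha\ge-\frac1p:f\in T^p_\alpha(x_0)\}$. The $p$-leaders are $l^{(p)}_\lambda=\sup_{j'\ge j}\left(\sum_{\lambda'\in\Lambda_{j'},\lambda'\subseteq3\lambda}|c_{\lambda'}|^p2^{-(j'-j)}\right)^{1/p}$ for $\lambda\in\Lambda_j$. If $p\ge1$ and $\eta_f(p)>0$, then $f\in L^p_{\mathrm{loc}}$ and it is known that $h_f^{(p)}(x_0)=\liminf_{j\to+\infty}\frac{\log l^{(p)}_{\lambda_j(x_0)}}{\log 2^{-j}}$; for $0<p<1$ with $\eta_f(p)>0$ this formula is the definition. $p$-spectrum: $\mathscr D_f^{(p)}(h)=\dim_{\mathcal H}\{x_0\in\mathbb R:h_f^{(p)}(x_0)=h\}$. *)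

(* Defs.v *)
From HB Require Import structures.
From mathcomp Require Import all_boot all_order all_algebra.
From mathcomp Require Import all_classical all_reals all_analysis.
Set Implicit Arguments.
Unset Strict Implicit.
Unset Printing Implicit Defensive.
Import Order.TTheory GRing.Theory Num.Theory.
Import numFieldNormedType.Exports.
Local Open Scope classical_set_scope.
Local Open Scope ring_scope.

(* Logarithm in base 2 with log2 0 = -oo. *)
Definition log2 (R : realType) (x : \bar R) : \bar R :=
  (lne x * ((ln 2)^-1)%:E)%E.

(** * Hausdorff dimension of subsets of the real line *)

(* [sup] is 0 on the empty set and on unbounded sets; below, [diam] is only
   applied to bounded sets. *)
Definition diam (R : realType) (A : set R) : R :=
  sup [set `|x - y| | x in A & y in A].

Definition fine_cover (R : realType) (delta : R) (A : set R)
    (U : nat -> set R) : Prop :=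
  A `<=` \bigcup_i U i /\
  forall i x y, U i x -> U i y -> `|x - y| <= delta.

Definition hausdorff_content (R : realType) (s delta : R) (A : set R) : \bar R :=
  ereal_inf [set (\sum_(0 <= i <oo) (diam (U i) `^ s)%:E)%E
            | U in fine_cover delta A].

Definition hausdorff_measure (R : realType) (s : R) (A : set R) : \bar R :=
  ereal_sup [set hausdorff_content s delta A | delta in [set d : R | 0 < d]].

(* Restricting to s > 0 does not change the infimum for nonempty A (H^0 is the
   counting measure) and avoids the convention 0 `^ 0 = 1. *)
Definition hausdorff_dim (R : realType) (A : set R) : \bar R :=
  if `[< A = set0 >] then -oo%E
  else ereal_inf [set s%:E | s in [set s : R |
         0 < s /\ hausdorff_measure s A = 0%E]].

(** * Periodized wavelet bases *)

Definition schwartz (R : realType) (psi : R -> R) : Prop :=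
  (forall (n : nat) (x : R), derivable (derive1n n psi) x 1) /\
  (forall m n : nat, exists C : R, forall x : R,
     `|x ^+ m * derive1n n psi x| <= C).

(* The sum over l in Z is the limit of the sums over -n <= l <= n; it converges
   absolutely for psi in the Schwartz class. *)
Definition psi_per (R : realType) (psi : R -> R) (j k : nat) (x : R) : R :=
  limn (fun n : nat =>
    \sum_(i < n.*2.+1) psi (2 ^+ j * (x - (i%:R - n%:R)) - k%:R)).

Definition inner01 (R : realType) (f g : R -> R) : R :=
  (\int[@lebesgue_measure R]_(x in `[0, 1]) (f x * g x))%R.

Definition Lp_int01 (R : realType) (p : R) (f : R -> R) : \bar R :=
  (\int[@lebesgue_measure R]_(x in `[0%R, 1%R]) (`|f x| `^ p)%:E)%E.

(* Coefficients are indexed by j and k < 2 ^ j; the values c j k with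
   2 ^ j <= k are never used. *)
Definition wavelet_partial_sum (R : realType) (psi : R -> R)
    (c : nat -> nat -> R) (J : nat) (x : R) : R :=
  \sum_(j < J) \sum_(k < 2 ^ j) c j k * psi_per psi j k x.

Definition psi_normalized (R : realType) (psi : R -> R) (j k : nat) (x : R) : R :=
  Num.sqrt (2 ^+ j) * psi_per psi j k x.

(* 1 and the functions psi_normalized psi j k (k < 2 ^ j) form an orthonormal
   basis of L^2([0, 1]): they are orthonormal, and every f in L^2([0, 1]) is the
   L^2-limit of its expansion. *)
Definition periodized_onb (R : realType) (psi : R -> R) : Prop :=
  [/\ forall j k : nat, (k < 2 ^ j)%N ->
        inner01 (psi_normalized psi j k) (cst 1) = 0,
      forall j k j' k' : nat, (k < 2 ^ j)%N -> (k' < 2 ^ j')%N ->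
        inner01 (psi_normalized psi j k) (psi_normalized psi j' k') =
        ((j == j') && (k == k'))%:R
    & forall f : R -> R,
        measurable_fun (`[0, 1]%classic : set R) f -> (Lp_int01 2 f < +oo)%E ->
        Lp_int01 2 (fun x => f x - (inner01 f (cst 1) +
          \sum_(j < J) \sum_(k < 2 ^ j)
             inner01 f (psi_normalized psi j k) * psi_normalized psi j k x))
        @[J --> \oo] --> 0%E].

Definition mother_wavelet (R : realType) (psi : R -> R) : Prop :=
  schwartz psi /\ periodized_onb psi.

Definition Lp_loc (R : realType) (p : R) (f : R -> R) : Prop :=
  measurable_fun setT f /\
  forall K : set R, compact K ->
    (\int[@lebesgue_measure R]_(x in K) (`|f x| `^ p)%:E < +oo)%E.

(* f is one-periodic and f = \sum_(j, k) c_(j,k) psi_(j,k), the series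
   converging in L^p over a period. *)
Definition is_wavelet_sum (R : realType) (psi : R -> R) (p : R)
    (c : nat -> nat -> R) (f : R -> R) : Prop :=
  [/\ Lp_loc p f,
      periodic f 1
    & Lp_int01 p (fun x => f x - wavelet_partial_sum psi c J x)
        @[J --> \oo] --> 0%E].

(* Determined by c up to a null set; the default value is only reached when the
   series has no sum in L^p, which cannot happen if p >= 1 and the scaling
   function is positive at p. *)
Definition wavelet_sum (R : realType) (psi : R -> R) (p : R)
    (c : nat -> nat -> R) : R -> R :=
  xget (cst 0) [set f | is_wavelet_sum psi p c f].

(** * Scaling function and wavelet density *)

Definition scaling_function (R : realType) (c : nat -> nat -> R) (p : R) : \bar R :=
  limn_einf (fun j : nat =>
    - ((j%:R^-1)%:E *
       log2 ((2 ^+ j)^-1 * \sum_(k < 2 ^ j) `|c j k| `^ p)%:E))%E.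

Definition density_count (R : realType) (c : nat -> nat -> R) (alpha eps : R)
    (j : nat) : nat :=
  #|[pred k : 'I_(2 ^ j) |
     2 `^ (- (alpha + eps) * j%:R) <= `|c j k| <= 2 `^ (- (alpha - eps) * j%:R)]|.

Definition wavelet_density (R : realType) (c : nat -> nat -> R) (alpha : R) : \bar R :=
  lim ((limn_esup (fun j : nat =>
          ((j%:R^-1)%:E * log2 ((density_count c alpha eps j)%:R)%:E)%E))
       @[eps --> 0^'+]).

(** * p-leaders, p-exponent and p-spectrum *)

Definition dyadic (R : realType) (j k : nat) : set R :=
  `[k%:R / 2 ^+ j, k.+1%:R / 2 ^+ j[%classic.

(* Neighbours are taken modulo 1, so that this is a subset of [0, 1). *)
Definition dyadic3 (R : realType) (j k : nat) : set R :=
  dyadic j ((k + 2 ^ j).-1 %% 2 ^ j) `|` dyadic j k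
    `|` dyadic j (k.+1 %% 2 ^ j).

(* The k < 2 ^ j such that dyadic j k contains the fractional part of x. *)
Definition dyadic_index (R : realType) (j : nat) (x : R) : nat :=
  Num.truncn (2 ^+ j * (x - (Num.floor x)%:~R)).

Definition p_leader (R : realType) (p : R) (c : nat -> nat -> R) (j k : nat) : \bar R :=
  ereal_sup [set ((\sum_(k' < 2 ^ j' | `[< @dyadic R j' k' `<=` dyadic3 j k >])
                     `|c j' k'| `^ p * (2 ^+ (j' - j))^-1) `^ p^-1)%:E
            | j' in [set j' : nat | (j <= j')%N]].

Definition leader_exponent (R : realType) (p : R) (c : nat -> nat -> R) (x0 : R) : \bar R :=
  limn_einf (fun j : nat =>
    lne (p_leader p c j (dyadic_index j x0)) * ((ln ((2 ^+ j)^-1))^-1)%:E)%E.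

(* f belongs to T^p_alpha(x0); the zero polynomial has degree -oo, so it is the
   only candidate for P when alpha <= 0. *)
Definition in_Tp (R : realType) (p : R) (f : R -> R) (alpha x0 : R) : Prop :=
  exists (C : R) (P : {poly R}) (r0 : R),
    [/\ 0 < C, P != 0 -> ((size P).-1)%:R < alpha, 0 < r0
      & forall r : R, 0 < r -> r <= r0 ->
        (((r^-1)%:E * \int[@lebesgue_measure R]_(x in ball x0 r)
            (`|f x - P.[x]| `^ p)%:E) `^ p^-1 <= (C * r `^ alpha)%:E)%E].

Definition Tp_exponent (R : realType) (p : R) (f : R -> R) (x0 : R) : \bar R :=
  ereal_sup [set alpha%:E | alpha in [set a : R | - p^-1 <= a /\ in_Tp p f a x0]].

(* A one-periodic function is identified with its wavelet coefficients c. For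
   p < 1 it need not be a function and its exponent is defined by p-leaders. *)
Definition p_exponent (R : realType) (psi : R -> R) (p : R)
    (c : nat -> nat -> R) (x0 : R) : \bar R :=
  if 1 <= p then Tp_exponent p (wavelet_sum psi p c) x0
  else leader_exponent p c x0.

Definition p_spectrum (R : realType) (psi : R -> R) (p : R)
    (c : nat -> nat -> R) (h : R) : \bar R :=
  hausdorff_dim [set x0 : R | p_exponent psi p c x0 = h%:E].

(* Main.v *)
From HB Require Import structures.
Require Import Defs.
From mathcomp Require Import all_boot all_order all_algebra.
From mathcomp Require Import all_classical all_reals all_analysis.
From mathcomp Require Import measurable_realfun zify ring lra.

(** The witness has a single singularity modulo 1. Put theta = alpha / h, which
    lies in (0, 1), let i be the integer part of theta j, and let the coefficients
    of level j be 2 ^ (- alpha j) on the 2 ^ (j - i) wavelets located in the block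
    [0, 2 ^ (- i)) and 0 elsewhere [chirp_coef].

    Every nonzero coefficient of level j has exponent exactly alpha. Hence the
    density is - oo below alpha, and so is the supremum over ]- 1 / p, h], while
    counting gives the density 1 - theta at alpha. For this value the middle
    expression of the claim is 0. What remains is that the set of points of
    exponent h is nonempty and of dimension 0. It contains 0 and consists of
    integers, hence it is countable [hausdorff_dim_countable]. The scaling function
    at p is theta + alpha p = theta p (h + 1 / p) > 0.

    The exponent is h at 0 because a block of length 2 ^ (- i) carries the amplitude
    2 ^ (- alpha j), which is (2 ^ (- i)) ^ h up to a constant: the sum of the series
    is an oscillating function of size |x| ^ h near 0. Away from the integers all
    but finitely many blocks are negligible.

    For p < 1 the exponent is defined by leaders, and its values at 0 and off the
    integers are obtained by counting coefficients [leader_exponent_chirp0,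
    leader_exponent_chirp_nonint].

    For p >= 1 the function itself is needed. The decay of the wavelets bounds the
    j-th block by the s-th power of the ratio of its length to the distance to the
    integers, for all s in [0, 1] [chirp_block_le]. For s > - h the series is
    then dominated by a geometric series times the power - s of that distance. With
    s < 1 / p this gives the convergence in L^p [chirp_is_wavelet_sum], the regularity
    - s at 0 for every such s [in_Tp_wave], and boundedness near the other points
    [in_Tp_wave_nonint]. Conversely, the orthogonality of the wavelets makes the
    pairing of the function with the sum of the wavelets of a block equal to
    2 ^ (- alpha j - i) [inner01_wave_block], although that sum is bounded and
    concentrated on the block; this is too large for a function of regularity more
    than h at 0 [in_Tp_wave_le]. Finally, the sum of a wavelet series is only
    defined up to a null set, to which the exponent is insensitive
    [is_wavelet_sum_unique, Tp_exponent_ae_eq]. *)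

Set Implicit Arguments.
Unset Strict Implicit.
Unset Printing Implicit Defensive.
Import Order.TTheory GRing.Theory Num.Theory.
Import numFieldNormedType.Exports.
Local Open Scope classical_set_scope.
Local Open Scope ring_scope.

(** * Powers of two *)

Lemma ln2_gt0 (R : realType) : 0 < ln 2 :> R.
Proof. by rewrite ln_gt0// ltr1n. Qed.

Lemma ltr_pow2 (R : realType) (x y : R) : (2 `^ x < 2 `^ y) = (x < y).
Proof. by rewrite /powR pnatr_eq0 /= ltr_expR ltr_pM2r// ln2_gt0. Qed.

Lemma ler_pow2 (R : realType) (x y : R) : (2 `^ x <= 2 `^ y) = (x <= y).
Proof. by rewrite !leNgt ltr_pow2. Qed.

Lemma pow2_gt0 (R : realType) (x : R) : 0 < 2 `^ x.
Proof. by rewrite powR_gt0. Qed.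

Lemma pow2D (R : realType) (x y : R) : 2 `^ (x + y) = 2 `^ x * 2 `^ y.
Proof. by rewrite powRD// pnatr_eq0 implybT. Qed.

Lemma pow2X (R : realType) (n : nat) : 2 ^+ n = 2 `^ n%:R :> R.
Proof. by rewrite powR_mulrn. Qed.

Lemma pow2XV (R : realType) (n : nat) : (2 ^+ n)^-1 = 2 `^ (- n%:R) :> R.
Proof. by rewrite powRN powR_mulrn. Qed.

Lemma ler_powRN (R : realType) (t x y : R) : 0 <= t -> 0 < x -> x <= y ->
  y `^ (- t) <= x `^ (- t).
Proof.
move=> t0 x0 xy; have y0 := lt_le_trans x0 xy.
by rewrite !powRN lef_pV2 ?posrE ?powR_gt0// ge0_ler_powR// nnegrE ltW.
Qed.

Lemma exists_log2 (R : realType) (x : R) : 0 < x -> exists k, x = 2 `^ k.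
Proof.
move=> x0; exists (ln x / ln 2); rewrite /powR pnatr_eq0/= divfK ?lnK//.
by rewrite gt_eqF// ln2_gt0.
Qed.

(** * Hausdorff dimension of countable sets *)

Lemma diam1 (R : realType) (x : R) : diam [set x] = 0.
Proof.
rewrite /diam (_ : [set _ | _ in _ & _ in _] = [set 0]) ?sup1//.
apply/seteqP; split => [y [a -> [b -> <-]]|y ->]; first by rewrite subrr normr0.
by exists x => //; exists x => //; rewrite subrr normr0.
Qed.

Lemma hausdorff_dim_countable (R : realType) (A : set R) :
  countable A -> A !=set0 -> hausdorff_dim A = 0%E.
Proof.
move=> cA A0; rewrite /hausdorff_dim; case: ifPn => [/asboolP A00|_].
  by case: A0 => x; rewrite A00.
have [f fA] : exists f : nat -> R, A `<=` range f.
  move/pfcard_geP : cA => [A00|[f]]; first by case: A0 => x; rewrite A00.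
  by exists f => x Ax; have [n _ <-] := 'surj_f Ax; exists n.
have H0 (s : R) : 0 < s -> hausdorff_measure s A = 0%E.
  move=> s0; have C0 d : 0 < d -> hausdorff_content s d A = 0%E.
    move=> d0; apply/eqP; rewrite eq_le; apply/andP; split; last first.
      apply: le_ereal_inf_tmp => _ [U _ <-]; apply: nneseries_ge0 => n _ _.
      by rewrite lee_fin powR_ge0.
    (* a countable set is covered by singletons, which have diameter 0 *)
    apply: ereal_inf_lbound; exists (fun n => [set f n]).
      split=> [x /fA[n _ <-]|i x y -> ->]; first by exists n.
      by rewrite subrr normr0 ltW.
    by rewrite eseries0// => n _ _; rewrite diam1 powR0// gt_eqF.
  rewrite /hausdorff_measure (_ : [set _ | _ in _] = [set 0%E]) ?ereal_sup1//.
  apply/seteqP; split => [_ [d /= d0 <-]|_ ->].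
    by rewrite C0.
  by exists 1 => //=; rewrite C0.
apply/eqP; rewrite eq_le; apply/andP; split; last first.
  by apply: le_ereal_inf_tmp => _ [s [s0 _] <-]; rewrite lee_fin ltW.
apply/lee_addgt0Pr => e e0; rewrite add0e; apply: ereal_inf_lbound.
by exists e => //; split => //; exact: H0.
Qed.

(** * Integrals over the real line *)

(** Both sides are measures that agree on half-open intervals. *)
Lemma lebesgue_measure_translation (R : realType) (z : R) (A : set R) :
  measurable A ->
  pushforward (@lebesgue_measure R) (fun x : R => x + z : measurableTypeR R) A
   = lebesgue_measure A.
Proof.
move=> mA.
pose g : measurableTypeR R -> measurableTypeR R := fun x => x + z.
have mg : measurable_fun setT g by exact: measurable_funD.
pose mixin := isMeasurableFun.Build _ _ _ _ _ mg.
pose f : {mfun measurableTypeR R >-> measurableTypeR R} := HB.pack g mixin.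
apply/esym.
apply: (@lebesgue_measure_unique R (pushforward (@lebesgue_measure R) f)) =>
  //= _ [[a b]] _ <-.
rewrite /pushforward.
have -> : f @^-1` [set` `]a, b]] = `]a - z, b - z]%classic.
  by apply/seteqP; split => x /=; rewrite !in_itv /= ltrBlDr lerBrDr.
rewrite !lebesgue_measure_itv /= !lte_fin ltrD2r; case: ifP => // _.
by congr (_%:E); ring.
Qed.

Lemma ge0_integral_translation (R : realType) (z : R) (D : set R) (f : R -> \bar R) :
  measurable D -> measurable_fun D f -> (forall x, D x -> (0 <= f x)%E) ->
  (\int[@lebesgue_measure R]_(x in D) f x =
   \int[@lebesgue_measure R]_(x in [set x | D (x + z)%R]) f (x + z)%R)%E.
Proof.
move=> mD mf f0.
pose g : measurableTypeR R -> measurableTypeR R := fun x => x + z.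
have mg : measurable_fun setT g by exact: measurable_funD.
rewrite -[RHS](@ge0_integral_pushforward _ _ _ _ R g mg lebesgue_measure D f)//.
  by apply: eq_measure_integral => A mA _; apply/esym/(lebesgue_measure_translation z mA).
by move=> y; rewrite inE => /f0.
Qed.

Lemma dyadic_scale (R : realType) (r y : R) : 0 < y < r ->
  exists n, r / 2 ^+ n.+1 <= y < r / 2 ^+ n.
Proof.
move=> /andP[y0 yr]; have r0 := lt_trans y0 yr.
have P k : (r / 2 ^+ k <= y) = (r / y <= 2 ^+ k).
  by rewrite ler_pdivrMr ?exprn_gt0// ler_pdivrMr// mulrC.
have ex : exists k, r / 2 ^+ k <= y.
  exists (Num.bound (r / y)); rewrite P; apply/ltW.
  apply: (lt_trans (archi_boundP _)); first by rewrite divr_ge0 ?ltW.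
  by rewrite -natrX ltr_nat ltn_expl.
case: (ex_minnP ex) => -[|n] ny nmin; first by rewrite expr0 divr1 leNgt yr in ny.
exists n; rewrite ny/= ltNge; apply/negP => /nmin; by rewrite ltnn.
Qed.

Lemma measurable_norm_powR (R : realType) (p : R) (D : set R) (f : R -> R) :
  measurable_fun D f -> measurable_fun D (fun x => `|f x| `^ p).
Proof.
move=> mf; apply: (measurableT_comp (measurable_powR _)).
exact: (measurableT_comp (@normr_measurable _ _)).
Qed.

Lemma measurable_norm_powRe (R : realType) (p : R) (D : set R) (f : R -> R) :
  measurable_fun D f -> measurable_fun D (fun x => (`|f x| `^ p)%:E).
Proof. by move=> mf; apply/measurable_EFinP; exact: (@measurable_norm_powR R p D f mf). Qed.

(** On the dyadic ring r / 2^(n+1) <= |x - m| < r / 2^n the power is at most its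
    value at the inner radius. Extending this bound to the whole ball of radius
    r / 2^n only costs a constant, and the integrals of the bounds form a
    geometric series. *)
Lemma integral_powR_ball_le (R : realType) (t : R) : 0 < t < 1 ->
  exists2 C : R, 0 < C & forall m r : R, 0 < r ->
    (\int[@lebesgue_measure R]_(x in ball m r) (`|x - m| `^ (- t))%:E
       <= (C * r `^ (1 - t))%:E)%E.
Proof.
move=> /andP[t0 t1].
pose q : R := 2 `^ (- (1 - t)).
have q0 : 0 < q by rewrite powR_gt0.
have q1 : q < 1.
  by rewrite -[ltRHS](powRr0 2) ltr_pow2 oppr_lt0 subr_gt0.
exists (2 * 2 `^ t * (1 - q)^-1).
  by rewrite !mulr_gt0 ?powR_gt0// invr_gt0 subr_gt0.
move=> m r r0.
pose a n : R := (r / 2 ^+ n.+1) `^ (- t).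
have rn0 n : 0 < r / 2 ^+ n by rewrite divr_gt0// exprn_gt0.
pose f n (x : R) : \bar R := ((a n)%:E * (\1_(ball m (r / 2 ^+ n)) x)%:E)%E.
have f0 n x : (0 <= f n x)%E.
  by rewrite mule_ge0// lee_fin// powR_ge0.
have mf n D : measurable_fun D (f n).
  apply: emeasurable_funM => //.
  apply/measurable_EFinP. apply: measurable_indic. exact: measurable_ball.
apply: (@le_trans _ _ (\int[@lebesgue_measure R]_(x in ball m r) (\sum_(n <oo) f n x))%E).
  apply: ge0_le_integral => //=.
  - exact: measurable_ball.
  - by apply: measurable_norm_powRe; exact: measurable_funB.
  - by apply: (@ge0_emeasurable_sum _ _ R (ball m r) f xpredT).
  move=> x; rewrite /ball /= distrC => xr.
  have [->|] := eqVneq `|x - m| 0.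
    (* at the singularity the negative power takes the value 0 *)
    by rewrite powR0 ?oppr_eq0 ?gt_eqF// nneseries_ge0.
  move=> y0; have {}y0 : 0 < `|x - m| by rewrite lt_neqAle eq_sym y0 normr_ge0.
  have [|n /andP[n1 n2]] := @dyadic_scale R r `|x - m|; first by rewrite y0.
  apply: (le_trans _ (nneseries_lim_ge n.+1 _)) => //.
  rewrite big_nat_recr//= -[leLHS]add0e leeD//; first exact: sume_ge0.
  rewrite /f indicE mem_set ?mule1 ?lee_fin; last by rewrite /ball/= distrC.
  by apply: ler_powRN => //; exact: ltW.
rewrite integral_nneseries//; try exact: measurable_ball.
have E n : (\int[lebesgue_measure]_(x in ball m r) f n x <=
   (2 * 2 `^ t * r `^ (1 - t) * q ^+ n)%:E)%E.
  have aE : a n * (r / 2 ^+ n *+ 2) = 2 * 2 `^ t * r `^ (1 - t) * q ^+ n.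
    rewrite /a powRM ?invr_ge0 ?exprn_ge0 ?ltW// pow2XV -powRrM.
    rewrite [r `^ (1 - t)]powRD ?powRr1 ?ltW ?(gt_eqF r0) ?implybT//.
    rewrite pow2XV /q -[_ ^+ n]powR_mulrn ?powR_ge0// -powRrM.
    have -> : - n.+1%:R * - t = t + (- n%:R * - t) :> R by rewrite -natr1; ring.
    have -> : - (1 - t) * n%:R = - n%:R * - t + - n%:R :> R by ring.
    by rewrite !pow2D mulr2n; ring.
  rewrite ge0_integralZl_EFin ?powR_ge0//; first last.
  - apply/measurable_EFinP; apply: measurable_indic; exact: measurable_ball.
  - exact: measurable_ball.
  rewrite integral_indic//; try exact: measurable_ball.
  rewrite -aE EFinM lee_pmul2l ?lte_fin ?powR_gt0//.
  rewrite -(lebesgue_measure_ball m (ltW (rn0 n))).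
  apply: le_measure; rewrite ?inE//=; try exact: measurable_ball.
  by apply: measurableI; exact: measurable_ball.
apply: (le_trans (lee_nneseries _ (fun n _ => E n))).
  by move=> n _ _; apply: integral_ge0.
apply: lime_le.
  by apply: is_cvg_nneseries => n _ _; rewrite lee_fin !mulr_ge0 ?powR_ge0 ?exprn_ge0// ltW.
apply: nearW => n; rewrite sumEFin lee_fin.
have := @geometric_le_lim R n (2 * 2 `^ t * r `^ (1 - t)) q.
rewrite !mulr_ge0 ?powR_ge0// ger0_norm ?(ltW q0)// => /(_ isT q0 q1).
rewrite seriesEnat/= => /le_trans; apply.
by rewrite -!mulrA ler_wpM2l// ler_wpM2l ?powR_ge0// mulrC.
by move=> n; exact: mf.
Qed.

(** * Density and scaling function of the chirp coefficients *)

Lemma cvgn_eq_pos (T : ptopologicalType) (u v : nat -> T) (l : T) :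
  (forall j, (0 < j)%N -> u j = v j) -> v @ \oo --> l -> u @ \oo --> l.
Proof.
move=> uv; rewrite -(cvg_shiftS v) -(cvg_shiftS u).
by rewrite (_ : [sequence _]_n = [sequence v n.+1]_n)//; apply/funext => j /=; rewrite uv.
Qed.

(** Density, scaling function and exponent are normalized by the level, so that
    the closed forms of their sequences hold from level 1 on. *)
Lemma limn_einf_esup_eq_pos (R : realType) (u v : nat -> \bar R) (l : \bar R) :
  (forall j, (0 < j)%N -> u j = v j) -> v @ \oo --> l ->
  limn_einf u = l /\ limn_esup u = l.
Proof. by move=> uv /(cvgn_eq_pos uv)/cvg_limn_einf_sup[]. Qed.

Lemma log2_pow2 (R : realType) (x : R) : log2 (2 `^ x)%:E = x%:E.
Proof.
rewrite /log2 lne_EFin ?pow2_gt0// -EFinM ln_powR -mulrA divff ?mulr1//.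
by rewrite gt_eqF// ln2_gt0.
Qed.

Lemma log2_0 (R : realType) : log2 (0%:E : \bar R) = -oo%E.
Proof.
rewrite /log2 le0_lneNy// gt0_mulNye// lte_fin invr_gt0; exact: ln2_gt0.
Qed.

Lemma card_ord_ltn (m n : nat) : (m <= n)%N -> #|[pred k : 'I_n | (k < m)%N]| = m.
Proof.
move=> mn; rewrite -sum1_card -(big_ord_widen n (fun=> 1%N))//.
by rewrite sum1_card card_ord.
Qed.

Definition cutoff (R : realType) (theta : R) (j : nat) : nat :=
  Num.truncn (theta * j%:R).

(** The coefficients of level j equal 2 ^ (- alpha j) on the wavelets located in
    [0, 2 ^ (- i)), where i = cutoff theta j is about theta j. For theta = alpha / h
    this is the analogue of the chirp |x|^h sin(1 / |x|^b): at scale 2 ^ (- i) the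
    amplitude 2 ^ (- alpha j) is of the order of (2 ^ (- i)) ^ h. *)
Definition chirp_coef (R : realType) (theta alpha : R) (j k : nat) : R :=
  if (k < 2 ^ (j - cutoff theta j))%N then 2 `^ (- alpha * j%:R) else 0.

Lemma cutoff_itv (R : realType) (theta : R) (j : nat) : 0 <= theta ->
  (cutoff theta j)%:R <= theta * j%:R < (cutoff theta j)%:R + 1.
Proof. by move=> t0; rewrite natr1; apply: truncn_itv; rewrite mulr_ge0. Qed.

Lemma cutoff_le (R : realType) (theta : R) (j : nat) : 0 <= theta <= 1 ->
  (cutoff theta j <= j)%N.
Proof.
move=> /andP[t0 t1]; rewrite -(ler_nat R).
have /andP[+ _] := cutoff_itv j t0; move=> /le_trans; apply.
by rewrite ler_piMl.
Qed.

Lemma cvg_cutoff (R : realType) (theta : R) : 0 <= theta ->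
  (fun j => (cutoff theta j)%:R / j%:R : R) @ \oo --> theta.
Proof.
move=> t0; rewrite -cvg_shiftS.
apply: (@squeeze_cvgr _ _ _ _ (fun j => theta - j.+1%:R^-1) (cst theta)).
- apply: nearW => j /=; have /andP[h1 h2] := cutoff_itv j.+1 t0.
  rewrite ler_pdivlMr// ler_pdivrMr// h1 andbT mulrBl mulVf ?pnatr_eq0//.
  by rewrite lerBlDr ltW.
- rewrite -[X in _ --> X]subr0; apply: cvgB; first exact: cvg_cst.
  exact: cvg_harmonic.
- exact: cvg_cst.
Qed.

Section chirp_density.
Context (R : realType) (theta alpha : R).
Hypothesis theta01 : 0 <= theta <= 1.
Let c := chirp_coef theta alpha.
Let theta0 : 0 <= theta. Proof. by case/andP : theta01. Qed.

Lemma pow2_cutoff_le j : (2 ^ (j - cutoff theta j) <= 2 ^ j)%N.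
Proof. by rewrite leq_exp2l// leq_subr. Qed.

Lemma natr_pow2_cutoff j :
  (2 ^ (j - cutoff theta j))%:R = 2 `^ (j%:R - (cutoff theta j)%:R) :> R.
Proof. by rewrite natrX pow2X natrB// cutoff_le. Qed.

(** All nonzero coefficients of level j equal 2 ^ (- alpha j), so for every
    positive tolerance the count is the length of the block. *)
Lemma wavelet_density_chirp : wavelet_density c alpha = (1 - theta)%:E.
Proof.
apply: lim_near_cst => //; near=> e.
have e0 : 0 < e by near: e; exact: nbhs_right_gt.
have cE j : density_count c alpha e j = (2 ^ (j - cutoff theta j))%N.
  rewrite -[RHS](card_ord_ltn (pow2_cutoff_le j)); apply: eq_card => k.
  rewrite !inE /c /chirp_coef; case: ifPn => _.
    rewrite ger0_norm ?powR_ge0// !ler_pow2.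
    by rewrite !ler_wpM2r// lerN2 ?lerDl ?gerBl ltW.
  by rewrite normr0 leNgt pow2_gt0.
apply: (proj2 (@limn_einf_esup_eq_pos _ _
  (fun j => (1 - (cutoff theta j)%:R / j%:R)%:E) _ _ _)).
  move=> j j0; rewrite cE natr_pow2_cutoff log2_pow2 -EFinM mulrBr mulVf//.
    by rewrite [in RHS]mulrC.
  by rewrite pnatr_eq0 -lt0n.
apply: cvg_EFin; first exact: nearW.
by apply: cvgB; [exact: cvg_cst|exact: cvg_cutoff].
Unshelve. all: by end_near. Qed.

(** For a tolerance less than alpha - a the count vanishes from level 1 on. *)
Lemma wavelet_density_chirp_lt a : a < alpha -> wavelet_density c a = -oo%E.
Proof.
move=> aalpha; apply: lim_near_cst => //; near=> e.
have e0 : e < alpha - a by near: e; apply: nbhs_right_lt; rewrite subr_gt0.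
apply: (proj2 (@limn_einf_esup_eq_pos _ _ (cst -oo%E) _ _ _)); last exact: cvg_cst.
move=> j j0; rewrite (_ : density_count c a e j = 0%N).
  rewrite log2_0 gt0_muleNy// lte_fin invr_gt0 ltr0n//.
rewrite /density_count eq_card0// => k; rewrite !inE /c /chirp_coef.
case: ifPn => _; last by rewrite normr0 leNgt pow2_gt0.
rewrite ger0_norm ?powR_ge0// !ler_pow2 ler_pM2r ?ltr0n// lerN2.
by rewrite leNgt -ltrBrDl e0.
Unshelve. all: by end_near. Qed.

Lemma sum_chirp_coef p j : 0 < p -> \sum_(k < 2 ^ j) `|c j k| `^ p =
  2 `^ (j%:R - (cutoff theta j)%:R - alpha * p * j%:R).
Proof.
move=> p0.
transitivity (\sum_(k < 2 ^ j | (k < 2 ^ (j - cutoff theta j))%N)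
    2 `^ (- alpha * p * j%:R)).
  rewrite [RHS]big_mkcond/=; apply: eq_bigr => k _; rewrite /c /chirp_coef.
  case: ifPn => _; last by rewrite normr0 powR0// gt_eqF.
  by rewrite ger0_norm ?powR_ge0// -powRrM mulrAC.
rewrite -(big_ord_widen _ (fun=> 2 `^ (- alpha * p * j%:R)) (pow2_cutoff_le j)).
rewrite sumr_const card_ord -[LHS]mulr_natl natr_pow2_cutoff -pow2D.
by rewrite !mulNr.
Qed.

Lemma scaling_function_chirp p : 0 < p ->
  scaling_function c p = (theta + alpha * p)%:E.
Proof.
move=> p0; apply: (proj1 (@limn_einf_esup_eq_pos _ _
  (fun j => ((cutoff theta j)%:R / j%:R + alpha * p)%:E) _ _ _)).
  move=> j j0; rewrite sum_chirp_coef// pow2XV -pow2D log2_pow2 -EFinM -EFinN.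
  have j1 : j%:R != 0 :> R by rewrite pnatr_eq0 -lt0n.
  by congr (_%:E); field.
apply: cvg_EFin; first exact: nearW.
by apply: cvgD; [exact: cvg_cutoff|exact: cvg_cst].
Qed.

End chirp_density.

(** * Leaders of the chirp coefficients *)

Lemma card_ord_itv_le (n a q : nat) : (#|[pred k : 'I_n | (a <= k < a + q)%N]| <= q)%N.
Proof.
set P := [pred k : 'I_n | _].
rewrite cardE -(size_map val) -[leqRHS](size_iota a); apply: uniq_leq_size.
  by rewrite map_inj_uniq ?enum_uniq//; exact: val_inj.
by move=> _ /mapP[k + ->]; rewrite mem_enum mem_iota.
Qed.

Lemma dyadic_left (R : realType) (j k : nat) : @dyadic R j k (k%:R / 2 ^+ j).
Proof.
by rewrite /dyadic /= in_itv /= lexx/= ltr_pM2r ?invr_gt0 ?exprn_gt0// ltr_nat.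
Qed.

(** Left endpoints tell which interval of level j contains a given interval of
    level j', and turn inclusion of sets into inequalities between indices. *)
Lemma dyadic_left_itv (R : realType) (j m j' k' : nat) : (j <= j')%N ->
  @dyadic R j m (k'%:R / 2 ^+ j') ->
  (m * 2 ^ (j' - j) <= k' < m * 2 ^ (j' - j) + 2 ^ (j' - j))%N.
Proof.
move=> jj'; rewrite /dyadic /= in_itv /= => /andP[].
have E : (2 ^+ j)^-1 = (2 ^ (j' - j))%:R / 2 ^+ j' :> R.
  by rewrite natrX -{2}(subnK jj') exprD invfM mulrA divff ?mul1r// expf_neq0.
have p0 : 0 < (2 ^+ j')^-1 :> R by rewrite invr_gt0 exprn_gt0.
rewrite E !mulrA ler_pM2r// ltr_pM2r// -!natrM ler_nat ltr_nat => -> /=.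
by rewrite mulSn addnC.
Qed.

Lemma card_dyadic3_le (R : realType) (j k j' : nat) : (j <= j')%N ->
  (#|[pred k' : 'I_(2 ^ j') | `[< @dyadic R j' k' `<=` dyadic3 j k >]]|
     <= 3 * 2 ^ (j' - j))%N.
Proof.
move=> jj'.
pose P m := [pred k' : 'I_(2 ^ j') |
  (m * 2 ^ (j' - j) <= k' < m * 2 ^ (j' - j) + 2 ^ (j' - j))%N].
pose m1 := ((k + 2 ^ j).-1 %% 2 ^ j)%N; pose m3 := (k.+1 %% 2 ^ j)%N.
apply: (@leq_trans #|[predU [predU P m1 & P k] & P m3]|).
  apply/subset_leq_card/fintype.subsetP => k'; rewrite !inE => sub.
  have [[|]|] := sub _ (dyadic_left R j' k');
    by move=> /(dyadic_left_itv jj') ->; rewrite ?orbT.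
have cardU (A B : pred 'I_(2 ^ j')) : (#|[predU A & B]| <= #|A| + #|B|)%N.
  by rewrite -cardUI leq_addr.
apply: (leq_trans (cardU _ _)); rewrite -[3%N]/(2 + 1)%N mulnDl mul1n.
apply: leq_add; last exact: card_ord_itv_le.
apply: (leq_trans (cardU _ _)); rewrite mul2n -addnn.
by apply: leq_add; exact: card_ord_itv_le.
Qed.

Lemma floor_itvD1 (R : realType) (x : R) :
  (Num.floor x)%:~R <= x < (Num.floor x)%:~R + 1.
Proof. by have := floor_itv x; rewrite rmorphD. Qed.

Section chirp_leader.
Context (R : realType) (h alpha p : R).
Hypotheses (hn : h < 0) (ha : h < alpha) (an : alpha < 0) (p0 : 0 < p)
  (hp : - p^-1 < h).
Let theta := alpha / h.
Let c := chirp_coef theta alpha.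

Let theta0 : 0 < theta. Proof. by rewrite /theta nmulr_rgt0// invr_lt0. Qed.
Let theta1 : theta < 1. Proof. by rewrite /theta ltr_ndivrMr// mul1r. Qed.
Let theta01 : 0 <= theta <= 1. Proof. by rewrite !ltW. Qed.
Let alphaE : alpha = theta * h. Proof. by rewrite /theta divfK// lt_eqF. Qed.
Let hp1 : 0 < h * p + 1.
Proof.
rewrite -(@pmulr_lgt0 _ p^-1) ?invr_gt0// mulrDl mulfK ?gt_eqF//.
by rewrite mul1r -ltrBlDr sub0r.
Qed.

Let leader_term (j k j' : nat) : R :=
  \sum_(k' < 2 ^ j' | `[< @dyadic R j' k' `<=` dyadic3 j k >])
     `|c j' k'| `^ p * (2 ^+ (j' - j))^-1.

Let term_ge0 j k j' : 0 <= leader_term j k j'.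
Proof. by apply: sumr_ge0 => k' _; rewrite mulr_ge0// powR_ge0. Qed.

(** A leader at level j is at most of the order 2 ^ (- h j). The level j' that
    matters is j / theta, where the block is as long as the interval; the terms
    of the higher levels decrease because h p + 1 > 0. *)
Lemma leader_term_le j k j' : (j <= j')%N ->
  leader_term j k j' <= 2 `^ (2 - h * p * (j%:R + 1)).
Proof.
move=> jj'.
have [h1 h2] := andP (cutoff_itv j' (ltW theta0)).
set i : R := (cutoff theta j')%:R in h1 h2.
pose t : R := 2 `^ (- (alpha * p) * j'%:R - (j'%:R - j%:R)).
pose m := (2 ^ (j' - cutoff theta j'))%N.
have le1 : leader_term j k j' <=
  #|[pred k' : 'I_(2 ^ j') | `[< @dyadic R j' k' `<=` dyadic3 j k >] && (k' < m)%N]|%:R * t.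
  rewrite mulr_natl -sumr_const big_mkcondr/=; apply: ler_sum => k' _.
  rewrite /c /chirp_coef -/m; case: ifPn => _; last first.
    by rewrite normr0 powR0 ?mul0r// gt_eqF.
  rewrite ger0_norm ?powR_ge0// -powRrM pow2XV -pow2D natrB//.
  by rewrite /t ler_pow2; lra.
apply: (le_trans le1).
have ij' : - alpha * j'%:R <= - h * (i + 1).
  have : theta * j'%:R * h >= (i + 1) * h by rewrite ler_nM2r// ltW.
  by rewrite alphaE; lra.
have ijp : - (alpha * p) * j'%:R <= - (h * p) * (i + 1).
  have : - alpha * j'%:R * p <= - h * (i + 1) * p by rewrite ler_pM2r.
  by lra.
(* when the block of level j' is at least as long as the interval, count the
   dyadic intervals in the three neighbours; otherwise count those in the block *)
have [ij|ji] := lerP i j%:R.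
  apply: (@le_trans _ _ ((3 * 2 ^ (j' - j))%N%:R * t)).
    rewrite ler_wpM2r ?powR_ge0// ler_nat; apply: leq_trans (card_dyadic3_le R k jj').
    by apply/subset_leq_card/fintype.subsetP => k'; rewrite !inE => /andP[/asboolW].
  apply: (@le_trans _ _ (2 `^ 2 * 2 `^ (j'%:R - j%:R) * t)).
    rewrite ler_wpM2r ?powR_ge0// natrM natrX pow2X natrB// ler_wpM2r ?powR_ge0//.
    by rewrite powR_mulrn// -natrX ler_nat.
  rewrite /t -!pow2D ler_pow2.
  have : - (h * p) * (i + 1) <= - (h * p) * (j%:R + 1).
    by rewrite ler_wpM2l ?lerD2r// oppr_ge0 mulr_le0_ge0// ltW.
  by lra.
apply: (@le_trans _ _ (m%:R * t)).
  rewrite ler_wpM2r ?powR_ge0// ler_nat.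
  rewrite -[leqRHS](card_ord_ltn (pow2_cutoff_le theta j')).
  by apply/subset_leq_card/fintype.subsetP => k'; rewrite !inE => /andP[].
rewrite natr_pow2_cutoff// -pow2D ler_pow2 -/i.
have : (h * p + 1) * j%:R <= (h * p + 1) * i by rewrite ler_pM2l// ltW.
by lra.
Qed.

(** Level j / theta is the one whose block has about the length of the interval
    of level j at 0: there the whole interval is filled. *)
Lemma le_leader_term0 j : let j' := Num.truncn (j%:R / theta) in
  (j <= j')%N /\ 2 `^ ((- h * j%:R + alpha) * p) <= leader_term j 0 j'.
Proof.
move=> j'.
have jt0 : 0 <= j%:R / theta by rewrite divr_ge0// ltW.
have := truncn_itv jt0; rewrite -/j' -natr1 => /andP[h1 h2].
have jj' : (j <= j')%N.
  rewrite -ltnS -(ltr_nat R) -natr1; apply: le_lt_trans h2.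
  by rewrite ler_pdivlMr// ler_piMr// ltW.
split=> //.
have cj : (cutoff theta j' <= j)%N.
  rewrite -(ler_nat R); have [+ _] := andP (cutoff_itv j' (ltW theta0)).
  move=> /le_trans; apply; rewrite mulrC -ler_pdivlMr//.
have sub (k' : 'I_(2 ^ j')) : (k' < 2 ^ (j' - j))%N ->
    @dyadic R j' k' `<=` dyadic3 j 0.
  move=> kj x; rewrite /dyadic /= in_itv /= => /andP[x1 x2]; left; right => /=.
  rewrite /dyadic /= in_itv /= mul0r (le_trans _ x1) ?divr_ge0 ?exprn_ge0//=.
  apply: (lt_le_trans x2).
  rewrite ler_pdivrMr ?exprn_gt0//.
  rewrite (_ : 1%:R / 2 ^+ j * 2 ^+ j' = 2 ^+ (j' - j)); last first.
    by rewrite -[j' in LHS](subnK jj') exprD; field; rewrite expf_neq0.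
  by rewrite -natrX ler_nat.
apply: (@le_trans _ _ (\sum_(k' < 2 ^ j' | (k' < 2 ^ (j' - j))%N)
   2 `^ (- (alpha * p) * j'%:R - (j'%:R - j%:R)))).
  rewrite -(big_ord_widen _ (fun=> 2 `^ (- (alpha * p) * j'%:R - (j'%:R - j%:R)))); last first.
    by rewrite leq_exp2l// leq_subr.
  rewrite sumr_const card_ord -[leRHS]mulr_natl natrX pow2X natrB// -pow2D ler_pow2.
  have : - alpha * p * (j%:R / theta - 1) <= - alpha * p * j'%:R.
    by rewrite ler_wpM2l ?mulr_ge0 ?oppr_ge0 ?ltW//; lra.
  have : - alpha * p * (j%:R / theta - 1) = - h * p * j%:R + alpha * p.
    by rewrite alphaE; field; rewrite gt_eqF.
  by lra.
rewrite /leader_term [leLHS]big_mkcond [leRHS]big_mkcond /=; apply: ler_sum => k' _.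
case: ifPn => kj; last by case: ifPn => // _; rewrite mulr_ge0// powR_ge0.
rewrite asboolT; last exact: sub.
rewrite /c /chirp_coef (leq_trans kj) ?leq_exp2l ?leq_sub2l//.
rewrite ger0_norm ?powR_ge0// -powRrM pow2XV -pow2D natrB// ler_pow2.
lra.
Qed.

Lemma dyadic_index0 j : dyadic_index j (0 : R) = 0%N.
Proof. by rewrite /dyadic_index floor0 subr0 mulr0 truncn0. Qed.

Lemma leader_exponent_chirp0 : leader_exponent p c 0 = h%:E.
Proof.
have /choice[l L] : forall j, exists l : R, p_leader p c j 0 = (2 `^ l)%:E /\
    - h * j%:R + alpha <= l <= - h * j%:R + (2 / p - h).
  move=> j; have b1 : (p_leader p c j 0 <= (2 `^ (- h * j%:R + (2 / p - h)))%:E)%E.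
    apply: ge_ereal_sup => _ [j' jj' <-]; rewrite lee_fin -/(leader_term j 0 j').
    have -> : - h * j%:R + (2 / p - h) = (2 - h * p * (j%:R + 1)) * p^-1.
      by field; rewrite gt_eqF.
    rewrite powRrM ge0_ler_powR ?invr_ge0 ?nnegrE ?powR_ge0//; first exact: ltW.
    exact: leader_term_le.
  have b2 : ((2 `^ (- h * j%:R + alpha))%:E <= p_leader p c j 0)%E.
    have [jj' le] := le_leader_term0 j.
    apply: (@le_trans _ _ (leader_term j 0 (Num.truncn (j%:R / theta)) `^ p^-1)%:E).
      rewrite lee_fin (_ : - h * j%:R + alpha = (- h * j%:R + alpha) * p * p^-1).
        by rewrite powRrM ge0_ler_powR ?invr_ge0 ?nnegrE ?powR_ge0// ltW.
      by rewrite mulfK// gt_eqF.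
    by apply: ereal_sup_ubound; exists (Num.truncn (j%:R / theta)).
  case: (p_leader p c j 0) b1 b2 => [l| |]//.
  rewrite !lee_fin => b1 b2; have l0 : 0 < l by apply: lt_le_trans b2; exact: pow2_gt0.
  have [k lE] := exists_log2 l0; exists k; split; first by rewrite lE.
  by rewrite lE !ler_pow2 in b1 b2; rewrite b1 b2.
apply: (proj1 (@limn_einf_esup_eq_pos _ _ (fun j => (- (l j / j%:R))%:E) _ _ _)).
  move=> j j0; rewrite dyadic_index0 (proj1 (L j)) lne_EFin ?pow2_gt0// -EFinM ln_powR.
  rewrite pow2XV ln_powR; congr (_%:E).
  by field; rewrite pnatr_eq0 -lt0n j0 gt_eqF// ln2_gt0.
apply: cvg_EFin; first exact: nearW.
rewrite -cvg_shiftS /=.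
apply: (@squeeze_cvgr _ _ _ _ (fun j => h - (2 / p - h) * j.+1%:R^-1)
  (fun j => h - alpha * j.+1%:R^-1)).
- apply: nearW => j /=; have /andP[l1 l2] := proj2 (L j.+1).
  have jj : j.+1%:R != 0 :> R by rewrite pnatr_eq0.
  have j0 : 0 < j.+1%:R^-1 :> R by rewrite invr_gt0.
  have E (K J : R) : J != 0 -> h - K / J = - ((- h * J + K) / J).
    by move=> J0; field.
  by rewrite !E// !lerN2 !ler_pM2r// l1 l2.
- rewrite -[X in _ --> X]subr0 -[X in _ --> _ - X](mulr0 (2 / p - h)).
  apply: cvgB; first exact: cvg_cst.
  by apply: cvgM; [exact: cvg_cst|exact: cvg_harmonic].
- rewrite -[X in _ --> X]subr0 -[X in _ --> _ - X](mulr0 alpha).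
  apply: cvgB; first exact: cvg_cst.
  by apply: cvgM; [exact: cvg_cst|exact: cvg_harmonic].
Qed.

Lemma fractional_part_itv (x : R) : x - (Num.floor x)%:~R != 0 ->
  0 < x - (Num.floor x)%:~R < 1.
Proof.
move=> x0; have /andP[h1 h2] := floor_itvD1 x.
by rewrite lt_neqAle eq_sym x0 subr_ge0 h1 ltrBlDl h2.
Qed.

(** Away from the integers, the three intervals stay away from 0; the two
    hypotheses on 2 / 2 ^ j prevent the neighbours from wrapping around modulo 1. *)
Lemma dyadic3_ge j (y : R) : 0 < y -> 2 / 2 ^+ j <= y -> 2 / 2 ^+ j <= 1 - y ->
  forall z, dyadic3 j (Num.truncn (2 ^+ j * y)) z -> y - 2 / 2 ^+ j <= z.
Proof.
move=> y0 jy j1y z; set k := Num.truncn _.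
have j0 : 0 < 2 ^+ j :> R by rewrite exprn_gt0.
have /truncn_itv : 0 <= 2 ^+ j * y by rewrite mulr_ge0// ltW.
rewrite -/k -natr1 => /andP[k1 k2].
have jy' : 2 <= 2 ^+ j * y by move: jy; rewrite ler_pdivrMr// mulrC.
have jy'' : 2 <= 2 ^+ j * (1 - y) by move: j1y; rewrite ler_pdivrMr// mulrC.
have k0 : (0 < k)%N.
  by rewrite lt0n; apply/eqP => k0; move: k2; rewrite k0; lra.
have kj : (k.+1 < 2 ^ j)%N.
  by rewrite -(ltr_nat R) natrX -natr1; lra.
have E1 : ((k + 2 ^ j).-1 %% 2 ^ j)%N = k.-1.
  rewrite -[in LHS](prednK k0) addSn /= modnDr modn_small//.
  by rewrite prednK// ltnW// ltnW.
have ge m : (k.-1 <= m)%N -> @dyadic R j m z -> y - 2 / 2 ^+ j <= z.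
  move=> km; rewrite /dyadic/= in_itv /= => /andP[mz _]; apply: le_trans mz.
  rewrite ler_pdivlMr// mulrBl divfK ?gt_eqF// mulrC.
  have : k%:R - 1 <= m%:R :> R by rewrite lerBlDr natr1 ler_nat -(prednK k0).
  by lra.
rewrite /dyadic3 E1 modn_small// => -[[]|]; apply: ge => //.
- exact: leq_pred.
- by rewrite (leq_trans (leq_pred _)).
Qed.

(** Only finitely many blocks reach a neighbourhood of a point that is not an
    integer, so its leaders vanish from some level on. *)
Lemma leader_exponent_chirp_nonint (x : R) : x - (Num.floor x)%:~R != 0 ->
  leader_exponent p c x = +oo%E.
Proof.
move=> /fractional_part_itv; set y := x - _ => /andP[y0 y1].
pose m := Num.min y (1 - y).
have m0 : 0 < m by rewrite lt_min y0 subr_gt0 y1.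
have [K KE] : exists K, m / 8 = 2 `^ (- K).
  by have [k ->] := exists_log2 (divr_gt0 m0 (ltr0n R 8)); exists (- k); rewrite opprK.
have [my m1y] : m <= y /\ m <= 1 - y by rewrite /m !ge_min !lexx orbT.
apply: (fst (cvg_limn_einf_sup _)); apply: cvg_near_cst; near=> j.
have j0 : (0 < j)%N by near: j; exact: nbhs_infty_gt.
have Kj : K <= theta * j%:R.
  rewrite -ler_pdivrMl//; near: j; exact: nbhs_infty_ger.
have tm : 2 `^ (- (theta * j%:R)) <= m / 8 by rewrite KE ler_pow2 lerN2.
have jm : (2 ^+ j)^-1 <= m / 8.
  by rewrite pow2XV; apply: le_trans tm; rewrite ler_pow2 lerN2 ler_piMl// ltW.
have leader0 : p_leader p c j (dyadic_index j x) = 0%E.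
  rewrite /p_leader (_ : [set _ | _ in _] = [set 0%E]) ?ereal_sup1//.
  have E j' : (j <= j')%N ->
      leader_term j (dyadic_index j x) j' `^ p^-1 = 0.
    move=> jj'; rewrite /leader_term big1 ?powR0 ?invr_eq0 ?gt_eqF// => k' /asboolW sub.
    rewrite /c /chirp_coef; case: ifPn => [kj'|]; last first.
      by rewrite normr0 powR0 ?mul0r// gt_eqF.
    (* the interval starts after m / 4, where the block of level j' has ended *)
    exfalso.
    have := dyadic3_ge y0 _ _ (sub _ (dyadic_left R j' k')).
    have -> : 2 / 2 ^+ j <= y by move: jm; lra.
    have -> : 2 / 2 ^+ j <= 1 - y by move: jm; lra.
    move=> /(_ isT isT); apply/negP; rewrite -ltNge.
    apply: (@lt_le_trans _ _ (2 `^ (1 - theta * j%:R))); last first.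
      by rewrite pow2D powRr1//; move: jm tm; lra.
    rewrite ltr_pdivrMr ?exprn_gt0//.
    apply: (@lt_le_trans _ _ (2 ^ (j' - cutoff theta j'))%:R); first by rewrite ltr_nat.
    rewrite natr_pow2_cutoff// pow2X -pow2D ler_pow2.
    have /andP[_ h2] := cutoff_itv j' (ltW theta0).
    have : theta * j%:R <= theta * j'%:R by rewrite ler_pM2l// ler_nat.
    by move: h2; lra.
  apply/seteqP; split => [_ [j' jj' <-]|_ ->].
    by rewrite -/(leader_term _ _ _) E.
  by exists j => /=; rewrite ?leqnn// -/(leader_term _ _ _) E.
rewrite leader0 le0_lneNy// pow2XV ln_powR lt0_mulNye// lte_fin invr_lt0.
by rewrite pmulr_llt0 ?ln2_gt0// oppr_lt0 ltr0n.
Unshelve. all: by end_near. Qed.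

End chirp_leader.

(** * Sums of wavelets over a block of positions *)

(** The derivative of t / (1 + |t|) is (1 + |t|)^(-2); this is a discrete form
    of that fact, which makes the sum of the shifted inverse squares telescope. *)
Lemma inv_sqr_le_telescope (R : realType) (t : R) :
  (1 + `|t|) ^- 2 <= 4 * ((t + 1) / (1 + `|t + 1|) - t / (1 + `|t|)).
Proof.
have n0 : 0 < 1 + `|t| by rewrite ltr_pwDl.
have n1 : 0 < 1 + `|t + 1| by rewrite ltr_pwDl.
rewrite -subr_ge0.
have -> : 4 * ((t + 1) / (1 + `|t + 1|) - t / (1 + `|t|)) - (1 + `|t|) ^- 2 =
  (4 * ((t + 1) * (1 + `|t|) - t * (1 + `|t + 1|)) * (1 + `|t|) - (1 + `|t + 1|))
   / ((1 + `|t|) ^+ 2 * (1 + `|t + 1|)).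
  by field; rewrite !gt_eqF.
apply: divr_ge0; last by rewrite mulr_ge0 ?exprn_ge0// ltW.
case: (lerP 0 t) => t0.
  have t1 : 0 <= t + 1 by rewrite addr_ge0.
  by rewrite !ger0_norm//; nra.
rewrite (ltr0_norm t0); case: (lerP 0 (t + 1)) => t1.
  by rewrite ger0_norm//; nra.
by rewrite ltr0_norm//; nra.
Qed.

Lemma sum_inv_sqr_le (R : realType) (y : R) (M : nat) :
  \sum_(m < M) (1 + `|y - m%:R|) ^- 2 <= 8.
Proof.
pose G (t : R) := t / (1 + `|t|).
have G1 t : `|G t| <= 1.
  have t1 : 0 < 1 + `|t| by rewrite ltr_pwDl.
  rewrite /G normrM normfV (gtr0_norm t1) ler_pdivrMr//.
  by rewrite mul1r ler_wpDl.
have le : \sum_(m < M) (1 + `|y - m%:R|) ^- 2 <= 4 * (G (M%:R - y) - G (- y)).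
  elim: M => [|M IH]; first by rewrite big_ord0 sub0r subrr mulr0.
  rewrite big_ord_recr/=; apply: le_trans (lerD IH _) _.
    by rewrite distrC; exact: inv_sqr_le_telescope.
  rewrite -mulrDr ler_pM2l// /G -[M.+1%:R]natr1.
  by rewrite (_ : M%:R - y + 1 = M%:R + 1 - y); [lra|ring].
have := G1 (M%:R - y); have := G1 (- y); rewrite !ler_norml; lra.
Qed.

Lemma sum_ord_mul (V : nmodType) (F : nat -> V) (a b : nat) :
  \sum_(i < a) \sum_(k < b) F (i * b + k)%N = \sum_(m < a * b) F m.
Proof.
elim: a => [|a IH]; first by rewrite !big_ord0.
by rewrite big_ord_recr/= IH mulSnr big_split_ord/=.
Qed.

(** The points 2 ^ j i + k, with k < 2 ^ j, are pairwise distinct integers: the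
    sum over the translates by the period and over the positions k is a single sum
    over integers, and its bound does not depend on j. *)
Lemma sum_inv_sqr_per_le (R : realType) (x : R) (j n M : nat) : (M <= 2 ^ j)%N ->
  \sum_(k < M) \sum_(i < n) (1 + `|2 ^+ j * (x - i%:R) - k%:R|) ^- 2 <= 8 :> R.
Proof.
move=> Mj.
apply: (@le_trans _ _ (\sum_(k < 2 ^ j) \sum_(i < n)
    (1 + `|2 ^+ j * (x - i%:R) - k%:R|) ^- 2)).
  rewrite (big_ord_widen _ (fun k => \sum_(i < n) (1 + `|2 ^+ j * (x - i%:R) - k%:R|) ^- 2) Mj).
  rewrite big_mkcond/=; apply: ler_sum => k _; case: ifPn => // _.
  by apply: sumr_ge0 => i _; rewrite invr_ge0 exprn_ge0// addr_ge0.
rewrite exchange_big/=.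
rewrite (eq_bigr (fun i : 'I_n => \sum_(k < 2 ^ j)
    (1 + `|2 ^+ j * x - (i * 2 ^ j + k)%N%:R|) ^- 2)).
  rewrite (sum_ord_mul (fun m => (1 + `|2 ^+ j * x - m%:R|) ^- 2)).
  exact: sum_inv_sqr_le.
move=> i _; apply: eq_bigr => k _; congr ((1 + `|_|) ^- 2).
by rewrite natrD natrM natrX; ring.
Qed.

(** The periodized wavelets are limits of such sums, over - n <= l <= n. *)
Definition sym_sum (R : realType) (g : R -> R) (n : nat) : R :=
  \sum_(i < n.*2.+1) g (i%:R - n%:R).

Lemma sym_sumS (R : realType) (g : R -> R) n :
  sym_sum g n.+1 = sym_sum g n + (g n.+1%:R + g (- n.+1%:R)).
Proof.
rewrite /sym_sum doubleS big_ord_recr big_ord_recl/=.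
rewrite sub0r (_ : n.*2.+2%:R - n.+1%:R = n.+1%:R); last first.
  by rewrite -mul2n -!natr1 natrM; ring.
rewrite (eq_bigr (fun i : 'I_(n.*2.+1) => g (i%:R - n%:R))); first by ring.
by move=> i _; congr g; rewrite /bump/= add1n -!natr1; ring.
Qed.

(** Grouping the terms at n and - n turns the symmetric partial sums into an
    ordinary series. *)
Lemma cvg_sym_sum (R : realType) (g : R -> R) (B : R) :
  (forall n, sym_sum (fun t => `|g t|) n <= B) -> cvgn (sym_sum g).
Proof.
move=> gB.
pose b n := g n.+1%:R + g (- n.+1%:R).
have E n : sym_sum g n = sym_sum g 0 + series b n.
  elim: n => [|n IH]; first by rewrite seriesEnat/= big_geq// addr0.
  rewrite sym_sumS IH -addrA !seriesEnat/=; congr (_ + _).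
  by rewrite big_nat_recr.
have -> : sym_sum g = (fun n => sym_sum g 0 + series b n).
  by apply/funext => n; rewrite E.
apply: is_cvgD; first exact: is_cvg_cst.
apply: normed_cvg; apply: nondecreasing_is_cvgn.
  by apply: nondecreasing_series => i _ _; exact: normr_ge0.
exists B => _ [n _ <-]; apply: le_trans (gB n).
change (\sum_(0 <= i < n) `|b i| <= sym_sum (fun t => `|g t|) n).
elim: n => [|n IH]; first by rewrite big_geq//; apply: sumr_ge0.
by rewrite sym_sumS big_nat_recr//=; apply: lerD => //; exact: ler_normD.
Qed.

Lemma cvg0_sym_sum (R : realType) (g : R -> R) (B : R) :
  (forall n, sym_sum (fun t => `|g t|) n <= B) ->
  (fun n => g n.+1%:R) @ \oo --> 0 /\ (fun n => g (- n.+1%:R)) @ \oo --> 0.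
Proof.
move=> gB.
have : cvgn (sym_sum (fun t => `|g t|)).
  apply: (@cvg_sym_sum _ _ B) => n; rewrite /sym_sum.
  by under eq_bigr do rewrite normr_id; exact: gB.
move=> /cvg_ex[l cl].
have d0 : (fun n => `|g n.+1%:R| + `|g (- n.+1%:R)|) @ \oo --> 0.
  have : (fun n => sym_sum (fun t => `|g t|) n.+1 - sym_sum (fun t => `|g t|) n) @ \oo --> l - l.
    by apply: cvgB => //; rewrite (cvg_shiftS (sym_sum _)).
  rewrite subrr; apply: cvg_trans; apply: near_eq_cvg; apply: nearW => n /=.
  by rewrite sym_sumS; ring.
split; apply/norm_cvg0P; apply: (squeeze_cvgr _ (cvg_cst 0) d0);
  by apply: nearW => n; rewrite normr_ge0 ?lerDl ?lerDr normr_ge0.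
Qed.

(** Shifting the index changes a symmetric sum by its two boundary terms, which
    tend to 0; this is why the periodized wavelets are periodic. *)
Lemma sym_sum_shift (R : realType) (g : R -> R) (B : R) :
  (forall n, sym_sum (fun t => `|g t|) n <= B) ->
  limn (sym_sum (fun t => g (t - 1))) = limn (sym_sum g).
Proof.
move=> gB; have [c1 c2] := cvg0_sym_sum gB.
have E n : sym_sum (fun t => g (t - 1)) n.+1 = sym_sum g n.+1 + g (- n.+2%:R) - g n.+1%:R.
  rewrite /sym_sum big_ord_recl [in RHS]big_ord_recr/=.
  rewrite (_ : 0%:R - n.+1%:R - 1 = - n.+2%:R); last by rewrite -!natr1; ring.
  rewrite (_ : (n.+1).*2%:R - n.+1%:R = n.+1%:R); last by rewrite -mul2n natrM; ring.
  rewrite (eq_bigr (fun i : 'I_((n.+1).*2) => g (i%:R - n.+1%:R))); first by ring.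
  by move=> i _; congr g; rewrite /bump/= add1n -!natr1; ring.
have cg : cvgn (sym_sum g) by exact: cvg_sym_sum gB.
apply: cvg_lim => //; rewrite -cvg_shiftS/=.
rewrite (_ : (fun n => sym_sum _ n.+1) =
  (fun n => sym_sum g n.+1 + g (- n.+2%:R) - g n.+1%:R)); last first.
  by apply/funext => n; rewrite E.
rewrite -[limn _]subr0 -[X in X - 0]addr0; apply: cvgB => //; apply: cvgD.
  by rewrite (cvg_shiftS (sym_sum g)).
by rewrite -(cvg_shiftS (fun n => g (- n.+1%:R))) in c2.
Qed.

Lemma schwartz_decay (R : realType) (psi : R -> R) (N : nat) : schwartz psi ->
  exists2 C : R, 0 < C & forall x, `|psi x| <= C * (1 + `|x|) ^- N.
Proof.
move=> [_ hs].
have [C0 H0] := hs 0%N 0%N; have [CN HN] := hs N 0%N.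
have C00 : 0 <= C0 by apply: le_trans (H0 0); exact: normr_ge0.
have CN0 : 0 <= CN by apply: le_trans (HN 0); exact: normr_ge0.
exists (2 ^+ N * (C0 + CN + 1)).
  by rewrite mulr_gt0 ?exprn_gt0// ltr_wpDl// addr_ge0.
move=> x; have x0 : 0 < 1 + `|x| by rewrite ltr_pwDl.
rewrite ler_pdivlMr ?exprn_gt0//.
have {}H0 : `|psi x| <= C0 by have := H0 x; rewrite /= expr0 mul1r.
have {}HN : `|x| ^+ N * `|psi x| <= CN by have := HN x; rewrite /= normrM normrX.
have [x1|x1] := lerP `|x| 1.
  have : (1 + `|x|) ^+ N <= 2 ^+ N by rewrite lerXn2r ?nnegrE ?(ltW x0)//; lra.
  move=> /(ler_wpM2l (normr_ge0 (psi x)))/le_trans; apply.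
  rewrite mulrC ler_wpM2l ?exprn_ge0//; lra.
have : (1 + `|x|) ^+ N <= (2 * `|x|) ^+ N.
  by rewrite lerXn2r ?nnegrE ?(ltW x0) ?mulr_ge0//; lra.
move=> /(ler_wpM2l (normr_ge0 (psi x)))/le_trans; apply.
rewrite exprMn mulrCA ler_wpM2l ?exprn_ge0// mulrC; lra.
Qed.

Lemma schwartz_measurable (R : realType) (psi : R -> R) : schwartz psi ->
  measurable_fun setT psi.
Proof.
move=> [hd _]; apply: continuous_measurable_fun => x.
by apply/differentiable_continuous/derivable1_diffP; exact: (hd 0%N x).
Qed.

Section periodization.
Context (R : realType) (psi : R -> R).
Hypothesis hpsi : schwartz psi.

Let g j k x t := psi (2 ^+ j * (x - t) - k%:R).

Lemma sum_sym_sum_le (j M : nat) (x K : R) : (M <= 2 ^ j)%N -> 0 <= K ->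
  (forall (k : 'I_M) (l : int),
     `|psi (2 ^+ j * (x - l%:~R) - k%:R)|
       <= K * (1 + `|2 ^+ j * (x - l%:~R) - k%:R|) ^- 2) ->
  forall n, \sum_(k < M) sym_sum (fun t => `|g j k x t|) n <= K * 8.
Proof.
move=> Mj K0 H n.
apply: (@le_trans _ _ (K * (\sum_(k < M) \sum_(i < n.*2.+1)
    (1 + `|2 ^+ j * ((x + n%:R) - i%:R) - k%:R|) ^- 2))).
  rewrite mulr_sumr; apply: ler_sum => k _; rewrite mulr_sumr.
  apply: ler_sum => i _; have := H k (i%:Z - n%:Z); rewrite /g.
  rewrite (_ : x - (i%:Z - n%:Z)%:~R = x + n%:R - i%:R :> R).
    by rewrite (_ : x - (i%:R - n%:R) = x + n%:R - i%:R); last ring.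
  by rewrite rmorphB/= -!pmulrn; ring.
by rewrite ler_wpM2l// sum_inv_sqr_per_le.
Qed.

Lemma schwartz_inv_sqr : exists2 K : R, 0 < K &
  forall j k x t, `|g j k x t| <= K * (1 + `|2 ^+ j * (x - t) - k%:R|) ^- 2.
Proof. by have [K K0 H] := schwartz_decay 2 hpsi; exists K => // j k x t; exact: H. Qed.

Lemma sym_sum_psi_le (j k : nat) (x : R) : (k < 2 ^ j)%N ->
  exists B, forall n, sym_sum (fun t => `|g j k x t|) n <= B.
Proof.
move=> kj; have [K K0 H] := schwartz_inv_sqr; exists (K * 8) => n.
have := @sum_sym_sum_le j (2 ^ j) x K (leqnn _) (ltW K0) (fun k l => H j k x l%:~R) n.
apply: le_trans; rewrite (bigD1 (Ordinal kj))//= lerDl.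
by apply: sumr_ge0 => i _; apply: sumr_ge0.
Qed.

Lemma cvg_psi_per (j k : nat) (x : R) : (k < 2 ^ j)%N ->
  sym_sum (g j k x) @ \oo --> psi_per psi j k x.
Proof.
by move=> kj; have [B HB] := sym_sum_psi_le x kj; apply: (cvg_sym_sum HB).
Qed.

Lemma psi_per_periodic (j k : nat) : (k < 2 ^ j)%N -> periodic (psi_per psi j k) 1.
Proof.
move=> kj x; have [B HB] := sym_sum_psi_le x kj.
rewrite -[RHS]/(limn (sym_sum (g j k x))) -(sym_sum_shift HB).
rewrite /psi_per; congr (limn _); apply/funext => n; apply: eq_bigr => i _.
by rewrite /g; congr psi; ring.
Qed.

Lemma measurable_psi_per (j k : nat) : (k < 2 ^ j)%N ->
  measurable_fun setT (psi_per psi j k).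
Proof.
move=> kj; apply: (@measurable_fun_cvg _ _ _ _ (fun n x => sym_sum (g j k x) n)).
  move=> n; apply: measurable_sum => i.
  apply: (measurableT_comp (schwartz_measurable hpsi)).
  apply: measurable_funB => //; apply: measurable_funM => //.
  exact: measurable_funB.
by move=> x _; exact: cvg_psi_per.
Qed.

Definition psi_block (j M : nat) (x : R) : R := \sum_(k < M) psi_per psi j k x.

(** Any bound of the wavelets by a multiple of the inverse square of the distance
    to the lattice point sums up to a bound of the whole block, uniformly in the
    level and in the length of the block. *)
Lemma psi_block_le (j M : nat) (x K : R) : (M <= 2 ^ j)%N -> 0 <= K ->
  (forall (k : 'I_M) (l : int),
     `|psi (2 ^+ j * (x - l%:~R) - k%:R)|
       <= K * (1 + `|2 ^+ j * (x - l%:~R) - k%:R|) ^- 2) ->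
  `|psi_block j M x| <= K * 8.
Proof.
move=> Mj K0 H.
have c : (fun n => \sum_(k < M) sym_sum (g j k x) n) @ \oo --> psi_block j M x.
  rewrite /psi_block; elim: M Mj {H} => [|M IH] Mj.
    by under eq_fun do rewrite big_ord0; rewrite big_ord0; exact: cvg_cst.
  under eq_fun do rewrite big_ord_recr; rewrite big_ord_recr/=.
  by apply: cvgD; [exact/IH/ltnW|exact: cvg_psi_per].
rewrite -(cvg_lim (@Rhausdorff R) (cvg_norm c)).
apply: limr_le; first exact: (cvgP _ (cvg_norm c)).
apply: nearW => n; apply: le_trans (sum_sym_sum_le Mj K0 H n).
apply: le_trans (ler_norm_sum _ _ _) _; apply: ler_sum => k _.
exact: ler_norm_sum.
Qed.

Lemma measurable_psi_block (j M : nat) : (M <= 2 ^ j)%N ->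
  measurable_fun setT (psi_block j M).
Proof.
move=> Mj; apply: measurable_sum => k; apply: measurable_psi_per.
exact: leq_trans (ltn_ord k) Mj.
Qed.

Lemma psi_block_bounded : exists2 B : R, 0 < B &
  forall j M x, (M <= 2 ^ j)%N -> `|psi_block j M x| <= B.
Proof.
have [K K0 H] := schwartz_inv_sqr; exists (K * 8); first by rewrite mulr_gt0.
by move=> j M x Mj; apply: psi_block_le => //; [exact: ltW|move=> k l; exact: H].
Qed.

(** At distance D from the integers, where D is at least twice the length of the
    block, every wavelet of the block is evaluated at distance at least
    2 ^ j D / 2 from its centre; N powers of the decay give the factor, and two
    more make the sum over the block converge. *)
Lemma psi_block_decay (N : nat) : exists2 B : R, 0 < B &
  forall j M x D, (M <= 2 ^ j)%N -> 0 < D -> M%:R <= 2 ^+ j * (D / 2) ->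
  (forall l : int, D <= `|x - l%:~R|) ->
  `|psi_block j M x| <= B * (2 ^+ j * (D / 2)) ^- N.
Proof.
have [C C0 H] := schwartz_decay (N + 2) hpsi.
exists (C * 8); first by rewrite mulr_gt0.
move=> j M x D Mj D0 MD xD; set E := 2 ^+ j * (D / 2).
have E0 : 0 < E by rewrite mulr_gt0 ?exprn_gt0 ?divr_gt0.
rewrite mulrAC; apply: psi_block_le => //.
  by rewrite mulr_ge0 ?invr_ge0 ?exprn_ge0 ?ltW.
move=> k l; set t := _ - _; apply: (le_trans (H t)).
rewrite -mulrA ler_pM2l// exprD invfM ler_wpM2r ?invr_ge0 ?exprn_ge0 ?addr_ge0//.
have tE : E <= 1 + `|t|.
  apply: (@le_trans _ _ `|t|); last by rewrite lerDr.
  rewrite /t; apply: le_trans (lerB_dist _ _).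
  rewrite normrM (gtr0_norm (exprn_gt0 _ _))// (ger0_norm (ler0n _ _)).
  have : 2 ^+ j * D <= 2 ^+ j * `|x - l%:~R| by rewrite ler_pM2l ?exprn_gt0.
  have : k%:R <= E by apply: le_trans MD; rewrite ler_nat ltnW.
  by rewrite /E; lra.
by rewrite lef_pV2 ?posrE ?exprn_gt0 ?lerXn2r ?nnegrE ?ltr_pwDl// ?addr_ge0 ?ltW.
Qed.

End periodization.

(** * The distance to the integers and geometric tails *)

Definition dist_int (R : realType) (x : R) : R :=
  Num.min (x - (Num.floor x)%:~R) (1 - (x - (Num.floor x)%:~R)).

Lemma dist_int_ge0 (R : realType) (x : R) : 0 <= dist_int x.
Proof.
have /andP[h1 h2] := floor_itvD1 x.
rewrite le_min; apply/andP; split; lra.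
Qed.

Lemma dist_int_le (R : realType) (x : R) (l : int) : dist_int x <= `|x - l%:~R|.
Proof.
have /andP[h1 h2] := floor_itvD1 x.
have n1 := ler_norm (x - l%:~R).
have n3 : l%:~R - x <= `|x - l%:~R| by rewrite distrC ler_norm.
have [lx|lx] := leP l (Num.floor x).
  have lx' : l%:~R <= (Num.floor x)%:~R :> R by rewrite ler_int.
  apply: (@le_trans _ _ (x - (Num.floor x)%:~R)); first by rewrite ge_min lexx.
  lra.
have lx' : (Num.floor x)%:~R + 1 <= l%:~R :> R.
  by rewrite -[1]/(1%:~R) -rmorphD ler_int lezD1.
apply: (@le_trans _ _ (1 - (x - (Num.floor x)%:~R))).
  by rewrite ge_min lexx orbT.
lra.
Qed.

Lemma dist_intE (R : realType) (x : R) : exists l : int, dist_int x = `|x - l%:~R|.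
Proof.
have /andP[h1 h2] := floor_itvD1 x.
rewrite /dist_int; case: leP => _.
  by exists (Num.floor x); rewrite ger0_norm// subr_ge0.
exists (Num.floor x + 1)%R; rewrite distrC ger0_norm.
  by rewrite rmorphD/=; lra.
by rewrite rmorphD/=; lra.
Qed.

Lemma dist_int_period (R : realType) (x : R) : dist_int (x + 1) = dist_int x.
Proof.
have E : Num.floor (x + 1) = (Num.floor x + 1)%R.
  apply/eqP; rewrite floor_eq rmorphD/= rmorphD/=.
  have /andP[h1 h2] := floor_itvD1 x; apply/andP; split; lra.
by rewrite /dist_int E rmorphD/=; congr (Num.min _ _); ring.
Qed.

Lemma dist_int_eq0 (R : realType) (x : R) : dist_int x = 0 -> exists l : int, x = l%:~R.
Proof.
by have [l ->] := dist_intE x => /normr0_eq0/eqP; rewrite subr_eq0 => /eqP ->; exists l.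
Qed.

Lemma dist_int_small (R : realType) (x : R) : `|x| <= 2^-1 -> dist_int x = `|x|.
Proof.
move=> x2; apply/eqP; rewrite eq_le; apply/andP; split.
  by have := dist_int_le x 0; rewrite subr0.
have [l ->] := dist_intE x.
have [->|l0] := eqVneq l 0; first by rewrite subr0.
have l1 : 1 <= `|l%:~R| :> R.
  by rewrite -intr_norm ler1z -gtz0_ge1 normr_gt0.
have := lerB_dist (l%:~R : R) x; rewrite distrC; move: x2; lra.
Qed.

Lemma countable_int (R : realType) : countable (range (fun l : int => l%:~R : R)).
Proof. exact: card_le_trans (card_image_le _ _) (countableP _). Qed.

Lemma negligible_dist_int_eq0 (R : realType) :
  (@lebesgue_measure R).-negligible [set x : R | dist_int x = 0].
Proof.
have cZ := countable_int R.
exists (range (fun l : int => l%:~R : R)); split.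
- apply: countable_measurable => // t; exact: measurable_set1.
- exact: countable_lebesgue_measure0.
- by move=> x /= /dist_int_eq0[l ->]; exists l.
Qed.

Lemma geometric_tail (R : realType) (a : nat -> R) (K q : R) :
  0 <= K -> 0 < q < 1 -> (forall j, `|a j| <= K * q ^+ j) ->
  cvgn (fun J => \sum_(j < J) a j) /\
  forall J, `|limn (fun J => \sum_(j < J) a j) - \sum_(j < J) a j| <= K / (1 - q) * q ^+ J.
Proof.
move=> K0 /andP[q0 q1] aK; set S := fun J => _.
have qn : `|q| < 1 by rewrite ger0_norm ?ltW.
have tail J n : `|S (J + n)%N - S J| <= K / (1 - q) * q ^+ J.
  have -> : S (J + n)%N - S J = \sum_(i < n) a (J + i)%N.
    by rewrite /S big_split_ord/= addrAC subrr add0r.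
  apply: (le_trans (ler_norm_sum _ _ _)).
  apply: (@le_trans _ _ (\sum_(i < n) K * q ^+ J * q ^+ i)).
    by apply: ler_sum => i _; rewrite -mulrA -exprD.
  have KJ0 : 0 <= K * q ^+ J by rewrite mulr_ge0// exprn_ge0// ltW.
  by have := geometric_le_lim n KJ0 q0 qn; rewrite seriesEord/= mulrAC.
have cS : cvgn S.
  have -> : S = series a by apply/funext => n; rewrite seriesEord.
  apply: normed_cvg; apply: nondecreasing_is_cvgn.
    by apply: nondecreasing_series => i _ _; exact: normr_ge0.
  exists (K / (1 - q)) => _ [n _ <-].
  change (\sum_(0 <= i < n) `|a i| <= K / (1 - q)).
  rewrite big_mkord.
  have := geometric_le_lim n K0 q0 qn; rewrite seriesEord/=.
  by apply: le_trans; apply: ler_sum => i _.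
split=> // J.
have c : `|S (J + n)%N - S J| @[n --> \oo] --> `|limn S - S J|.
  apply: cvg_norm; apply: cvgB; last exact: cvg_cst.
  rewrite (_ : (fun n => S (J + n)%N) = (fun n => S (n + J)%N)).
    by rewrite (cvg_shiftn J S).
  by apply/funext => n; rewrite addnC.
rewrite -(cvg_lim (@Rhausdorff R) c).
apply: limr_le; first exact: (cvgP _ c).
by apply: nearW => n.
Qed.

Lemma dist_int_le1 (R : realType) (x : R) : dist_int x <= 1.
Proof.
have /andP[h1 h2] := floor_itvD1 x.
by rewrite /dist_int ge_min; apply/orP; left; lra.
Qed.

(** On a bounded set the distance to the integers is the distance to one of
    finitely many integers, so its negative powers are dominated by an integrable
    sum of powers of the distance to each of them. *)
Lemma dist_int_weight (R : realType) (t r : R) (D : set R) :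
  0 < t < 1 -> 0 < r -> measurable D -> D `<=` ball 0 r ->
  exists W : R -> R, [/\ measurable_fun setT W, forall x, 0 <= W x,
    (\int[@lebesgue_measure R]_(x in D) (W x)%:E < +oo)%E &
    forall x, D x -> dist_int x `^ (- t) <= W x].
Proof.
move=> t01 r0 mD Dr.
(* the nearest integer to a point of D has absolute value at most r + 1 *)
pose n := (Num.truncn r).+2.
have rn : r + 1 <= n%:R.
  by rewrite /n -natr1 lerD2r -natr1 ltW// natr1 truncnS_gt.
pose f (l x : R) := `|x - l| `^ (- t).
have mf l : measurable_fun setT (f l).
  have mB : measurable_fun setT (fun x : R => x - l) by exact: measurable_funB.
  exact: (measurable_norm_powR (- t) mB).
have f0 l x : 0 <= f l x by exact: powR_ge0.
exists (fun x => sym_sum (f^~ x) n); split.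
- by apply: measurable_sum => i; exact: mf.
- by move=> x; apply: sumr_ge0 => i _; exact: f0.
- under eq_integral do rewrite -sumEFin.
  rewrite ge0_integral_sum//; first last.
  + by move=> i x _; rewrite lee_fin.
  + by move=> i; apply/measurable_EFinP/measurable_funTS; exact: mf.
  apply/lte_sum_pinfty => i _; set l := i%:R - n%:R.
  have [C C0 HC] := integral_powR_ball_le t01.
  have rl : 0 < r + `|l| by rewrite ltr_wpDr.
  apply: (@le_lt_trans _ _ (C * (r + `|l|) `^ (1 - t))%:E); last by rewrite ltry.
  apply: le_trans (HC l _ rl); apply: ge0_subset_integral => //=.
  + exact: measurable_ball.
  + by apply/measurable_EFinP/measurable_funTS; exact: mf.
  + by move=> x _; rewrite lee_fin.
  + move=> x /Dr; rewrite /ball/= sub0r normrN distrC => xr.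
    by apply: (le_lt_trans (ler_normB _ _)); rewrite ltrD2r.
move=> x /Dr; rewrite /ball/= sub0r normrN => xr.
have [l lE] := dist_intE x.
have ln : `|l| <= n%:Z.
  rewrite -(ler_int R) intr_norm; have := dist_int_le1 x; rewrite lE.
  have := lerB_dist (l%:~R : R) x; rewrite distrC -pmulrn; move: xr rn; lra.
pose i := `|(l + n%:Z)%R|%N.
have iE : i%:Z = l + n%:Z by rewrite /i; lia.
have ln' : (i < n.*2.+1)%N by lia.
rewrite /sym_sum (bigD1 (Ordinal ln'))//= -[leLHS]addr0 lerD//; last exact: sumr_ge0.
rewrite /f lE (_ : i%:R - n%:R = l%:~R)//.
by rewrite (pmulrn _ i) iE rmorphD/= -pmulrn; ring.
Qed.

(** * The chirp *)

Lemma measurable_dist_int_eq0 (R : realType) : measurable [set x : R | dist_int x = 0].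
Proof.
apply: countable_measurable => [t|]; first exact: measurable_set1.
apply: sub_countable (countable_int R); apply: subset_card_le => x /= /dist_int_eq0[l ->].
by exists l.
Qed.

Section chirp_wave.
Context (R : realType) (psi : R -> R) (theta alpha : R).
Hypothesis hpsi : schwartz psi.
Hypotheses (theta0 : 0 < theta) (theta1 : theta < 1).
Let c := chirp_coef theta alpha.
Let m j := (2 ^ (j - cutoff theta j))%N.
Let theta01 : 0 <= theta <= 1. Proof. by rewrite !ltW. Qed.

Definition chirp_block j (x : R) := psi_block psi j (m j) x.

Lemma chirp_partial_sumE J x : wavelet_partial_sum psi c J x =
  \sum_(j < J) 2 `^ (- alpha * j%:R) * chirp_block j x.
Proof.
apply: eq_bigr => j _; rewrite /chirp_block /psi_block mulr_sumr.
rewrite (big_ord_widen _ (fun k => 2 `^ (- alpha * j%:R) * psi_per psi j k x)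
  (pow2_cutoff_le theta j)).
rewrite [RHS]big_mkcond/=; apply: eq_bigr => k _; rewrite /c /chirp_coef.
by case: ifPn => // _; rewrite mul0r.
Qed.

Lemma pow2_cutoff_lt j : 2 `^ (- (cutoff theta j)%:R) < 2 * 2 `^ (- (theta * j%:R)) :> R.
Proof.
rewrite -[X in X * _](powRr1 (ler0n _ 2)) -pow2D ltr_pow2.
by have /andP[_] := cutoff_itv j (ltW theta0); lra.
Qed.

(** Beyond twice its length, the block decays like the inverse of 2 ^ j times the
    distance, which is better than the ratio of its length to the distance. *)
Lemma chirp_block_bounds : exists2 B : R, 0 < B & forall j x,
  `|chirp_block j x| <= B /\ `|chirp_block j x| * dist_int x <= B * 2 `^ (- (theta * j%:R)).
Proof.
have [B0 B00 H0] := psi_block_bounded hpsi.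
have [B1 B10 H1] := psi_block_decay hpsi 1.
exists (4 * B0 + 2 * B1); first by rewrite addr_gt0// mulr_gt0.
move=> j x; have b0 := H0 j (m j) x (pow2_cutoff_le theta j).
rewrite -/(chirp_block j x) in b0.
split; first by apply: (le_trans b0); lra.
have jt : 2 `^ (- j%:R) <= 2 `^ (- (theta * j%:R)) :> R.
  by rewrite ler_pow2 lerN2 ler_piMl// ltW.
have t0 := pow2_gt0 (- (theta * j%:R) : R).
have := pow2_cutoff_lt j; set e := 2 `^ (- (cutoff theta j)%:R) => et.
have e0 : 0 < e := pow2_gt0 _.
set T := 2 `^ (- (theta * j%:R)) in jt t0 et *.
have [dx|dx] := lerP (2 * e) (dist_int x).
  have d0 : 0 < dist_int x by apply: lt_le_trans dx; rewrite mulr_gt0.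
  have p0 : 0 < 2 ^+ j * (dist_int x / 2) by rewrite mulr_gt0 ?exprn_gt0 ?divr_gt0.
  have := H1 j (m j) x (dist_int x) (pow2_cutoff_le theta j) d0 _ (dist_int_le x).
  rewrite natr_pow2_cutoff// pow2D -pow2X -/e ler_pM2l ?exprn_gt0//.
  have -> : e <= dist_int x / 2 by lra.
  move=> /(_ isT); rewrite expr1 -/(chirp_block j x) ler_pdivlMr// => b1.
  have j0 : 0 < 2 ^+ j :> R by rewrite exprn_gt0.
  apply: (@le_trans _ _ (2 * B1 * (2 ^+ j)^-1)).
    by rewrite ler_pdivlMr//; lra.
  rewrite pow2XV; apply: (@le_trans _ _ (2 * B1 * T)); first by rewrite ler_pM2l// mulr_gt0.
  by rewrite ler_pM2r//; lra.
apply: (@le_trans _ _ (B0 * (4 * T))).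
  by apply: ler_pM => //; [exact: dist_int_ge0|lra].
rewrite mulrA ler_pM2r//; lra.
Qed.

(** Interpolates between the two bounds of chirp_block_bounds. With
    theta s > - alpha the product of this bound with the amplitude 2 ^ (- alpha j)
    decreases geometrically in j. *)
Lemma chirp_block_le : exists2 B : R, 0 < B & forall s j x, 0 <= s <= 1 ->
  0 < dist_int x ->
  `|chirp_block j x| <= B * (2 `^ (- (theta * s * j%:R)) * dist_int x `^ (- s)).
Proof.
have [B B0 H] := chirp_block_bounds; exists B => // s j x /andP[s0 s1] d0.
have [b1 b2] := H j x.
pose u := 2 `^ (- (theta * j%:R)) / dist_int x.
have u0 : 0 < u by rewrite divr_gt0 ?pow2_gt0.
have -> : 2 `^ (- (theta * s * j%:R)) * dist_int x `^ (- s) = u `^ s.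
  rewrite /u powRM ?powR_ge0 ?invr_ge0 ?(ltW d0)// -powRrM -powR_inv1 ?(ltW d0)//.
  by rewrite -powRrM mulN1r; congr (2 `^ _ * _); ring.
(* min(1, u) <= u ^ s, as 0 <= s <= 1 *)
have [u1|u1] := lerP u 1.
  apply: (@le_trans _ _ (B * u)); first by rewrite mulrA ler_pdivlMr.
  by rewrite ler_pM2l// ger1_powR// u0 u1.
apply: (le_trans b1); rewrite ler_peMr//; first exact: ltW.
by rewrite -(powRr0 u) ler_powR// ltW.
Qed.

(** The series has no reason to converge at the integers, where its sum is
    replaced by 0. *)
Definition chirp_wave (x : R) : R :=
  if dist_int x == 0 then 0 else limn (fun J => wavelet_partial_sum psi c J x).

Lemma chirp_wave_rate s : 0 <= s <= 1 -> - alpha < theta * s ->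
  exists K q : R, [/\ 0 < K, 0 < q < 1 & forall x, 0 < dist_int x ->
    (fun J => wavelet_partial_sum psi c J x) @ \oo --> chirp_wave x /\
    forall J, `|chirp_wave x - wavelet_partial_sum psi c J x|
       <= K * q ^+ J * dist_int x `^ (- s)].
Proof.
move=> s01 as0; have [B B0 HB] := chirp_block_le.
pose q : R := 2 `^ (- alpha - theta * s).
have q0 : 0 < q := pow2_gt0 _.
have q1 : q < 1 by rewrite -[ltRHS](powRr0 2) ltr_pow2 subr_lt0.
exists (B / (1 - q)), q; split; first by rewrite divr_gt0// subr_gt0.
  by rewrite q0.
move=> x d0; pose D := dist_int x `^ (- s).
have D0 : 0 < D by exact: powR_gt0.
have [] := @geometric_tail R (fun j => 2 `^ (- alpha * j%:R) * chirp_block j x) (B * D) q.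
- by rewrite mulr_ge0// ltW.
- by rewrite q0.
- move=> j; rewrite normrM ger0_norm ?powR_ge0//.
  apply: le_trans (ler_wpM2l (powR_ge0 _ _) (HB s j x s01 d0)) _.
  rewrite -/D -[q ^+ j]powR_mulrn ?(ltW q0)// /q -powRrM.
  by rewrite (_ : (_ - _) * _ = - alpha * j%:R + - (theta * s * j%:R)) ?pow2D; [lra|ring].
rewrite /chirp_wave gt_eqF//.
have -> : (fun J => \sum_(j < J) 2 `^ (- alpha * j%:R) * chirp_block j x) =
    (fun J => wavelet_partial_sum psi c J x).
  by apply/funext => J; rewrite chirp_partial_sumE.
move=> cS tail; split=> // J; rewrite chirp_partial_sumE.
apply: (le_trans (tail J)); rewrite -/D le_eqVlt; apply/orP; left; apply/eqP; ring.
Qed.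

Lemma measurable_partial_sum J : measurable_fun setT (wavelet_partial_sum psi c J).
Proof.
rewrite (_ : wavelet_partial_sum _ _ _ =
  fun x => \sum_(j < J) 2 `^ (- alpha * j%:R) * chirp_block j x).
  apply: measurable_sum => j; apply: measurable_funM => //.
  by rewrite /chirp_block; exact: (measurable_psi_block hpsi (pow2_cutoff_le theta j)).
by apply/funext => x; exact: chirp_partial_sumE.
Qed.

Lemma measurable_chirp_wave s : 0 <= s <= 1 -> - alpha < theta * s ->
  measurable_fun setT chirp_wave.
Proof.
move=> s01 as0; have [K [q [_ _ H]]] := chirp_wave_rate s01 as0.
apply: (@measurable_fun_cvg _ _ _ _
  (fun J x => \1_(~` [set x : R | dist_int x = 0]) x * wavelet_partial_sum psi c J x)).
  move=> J; apply: measurable_funM; last exact: measurable_partial_sum.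
  by apply/measurable_indic/measurableC; exact: measurable_dist_int_eq0.
move=> x _; have [d0|d0] := eqVneq (dist_int x) 0.
  rewrite /chirp_wave d0 eqxx; apply: cvg_near_cst; apply: nearW => J.
  by rewrite indicE memNset ?mul0r//= d0.
have dp : 0 < dist_int x by rewrite lt_neqAle eq_sym d0 dist_int_ge0.
have [c0 _] := H x dp.
apply: cvg_trans c0; apply: near_eq_cvg; apply: nearW => J.
by rewrite indicE mem_set ?mul1r//=; exact/eqP.
Qed.

Lemma chirp_wave_periodic : periodic chirp_wave 1.
Proof.
move=> x; rewrite /chirp_wave dist_int_period; case: ifP => // _.
congr (limn _); apply/funext => J; rewrite /wavelet_partial_sum.
by apply: eq_bigr => j _; apply: eq_bigr => k _; rewrite (psi_per_periodic hpsi).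
Qed.

End chirp_wave.

(** * Uniqueness of the sum of a wavelet series *)

Lemma periodic1_int (R : realType) (f : R -> R) (x : R) (l : int) :
  periodic f 1 -> f (x - l%:~R) = f x.
Proof.
move=> pf; case: l => n.
  by rewrite -pmulrn -(periodicn pf n (x - n%:R)) subrK.
by rewrite NegzE rmorphN/= opprK -pmulrn (periodicn pf).
Qed.

Lemma negligible_translation (R : realType) (z : R) (N : set R) :
  (@lebesgue_measure R).-negligible N ->
  (@lebesgue_measure R).-negligible [set x : R | N (x + z)].
Proof.
move=> [A [mA A0 NA]]; exists [set x : R | A (x + z)]; split.
- rewrite -[X in measurable X]setTI.
  have mg : measurable_fun setT (fun x : R => x + z) by exact: measurable_funD.
  exact: mg.
- by have := lebesgue_measure_translation z mA; rewrite A0.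
- by move=> x /NA.
Qed.

Lemma powR_addM_le (R : realType) (a b p : R) : 0 <= a -> 0 <= b -> 0 <= p ->
  (a + b) `^ p <= 2 `^ p * (a `^ p + b `^ p).
Proof.
move=> a0 b0 p0; wlog ab : a b a0 b0 / a <= b.
  move=> H; have [/H|/ltW/H] := leP a b; first exact.
  by rewrite addrC [X in _ * X]addrC; exact.
apply: (@le_trans _ _ ((2 * b) `^ p)).
  by rewrite ge0_ler_powR ?nnegrE ?addr_ge0 ?mulr_ge0//; lra.
by rewrite powRM// ler_wpM2l ?powR_ge0// lerDr powR_ge0.
Qed.

Lemma Lp_int01_ge0 (R : realType) (p : R) (f : R -> R) : (0 <= Lp_int01 p f)%E.
Proof. by apply: integral_ge0 => x _; rewrite lee_fin powR_ge0. Qed.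

Lemma Lp_int01_triangle (R : realType) (p : R) (f g S : R -> R) : 0 <= p ->
  measurable_fun setT f -> measurable_fun setT g -> measurable_fun setT S ->
  (Lp_int01 p (fun x => f x - g x)%R <= (2 `^ p)%:E *
    (Lp_int01 p (fun x => f x - S x)%R + Lp_int01 p (fun x => g x - S x)%R))%E.
Proof.
move=> p0 mf mg mS; rewrite /Lp_int01.
have m2 (u v : R -> R) : measurable_fun setT u -> measurable_fun setT v ->
    measurable_fun (`[0, 1]%classic : set R) (fun x => (`|u x - v x| `^ p)%:E).
  move=> mu mv; apply: measurable_norm_powRe; apply: measurable_funTS.
  exact: measurable_funB.
rewrite -ge0_integralD//=; first last.
- exact: m2.
- exact: m2.
rewrite -ge0_integralZl_EFin ?powR_ge0//; first last.
- by apply: emeasurable_funD; exact: m2.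
- by move=> x _; rewrite adde_ge0// lee_fin powR_ge0.
apply: ge0_le_integral => //=.
- exact: m2.
- apply: emeasurable_funM => //; apply: emeasurable_funD; exact: m2.
- move=> x _; rewrite lee_fin.
  apply: le_trans (powR_addM_le _ _ p0) => //.
  rewrite ge0_ler_powR ?nnegrE ?addr_ge0//.
  by rewrite (_ : f x - g x = (f x - S x) - (g x - S x)); [exact: ler_normB|ring].
Qed.

(** The L^p distance between f and g over a period vanishes, because both are
    limits of the same partial sums; the null set of a period is then translated
    by the integers. It makes the choice of a representative harmless. *)
Lemma is_wavelet_sum_unique (R : realType) (psi : R -> R) (p : R) c (f g : R -> R) :
  0 < p -> (forall J, measurable_fun setT (wavelet_partial_sum psi c J)) ->
  is_wavelet_sum psi p c f -> is_wavelet_sum psi p c g ->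
  ae_eq (@lebesgue_measure R) setT f g.
Proof.
move=> p0 mS [[mf _] pf cf] [[mg _] pg cg].
have I0 : Lp_int01 p (fun x => f x - g x) = 0%E.
  apply/eqP; rewrite eq_le Lp_int01_ge0 andbT.
  have c0 : ((2 `^ p)%:E * (Lp_int01 p (fun x => f x - wavelet_partial_sum psi c J x)%R +
     Lp_int01 p (fun x => g x - wavelet_partial_sum psi c J x)%R))%E @[J --> \oo] --> 0%E.
    rewrite -[X in _ --> X](mule0 (2 `^ p)%:E); apply: cvgeZl => //.
    have def00 : ((0 : \bar R) +? 0)%E by exact: fin_num_adde_defr.
    have h := cvgeD def00 cf cg; rewrite adde0 in h.
    exact: h.
  apply: (cvge_to_ge c0); apply: nearW => J.
  by apply: Lp_int01_triangle => //; exact: ltW.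
have mfg : measurable_fun (`[0, 1]%classic : set R) (fun x => (`|f x - g x| `^ p)%:E).
  by apply: measurable_norm_powRe; apply: measurable_funTS; exact: measurable_funB.
have mD : measurable (`[0, 1]%classic : set R) by exact: measurable_itv.
have N0 : ae_eq (@lebesgue_measure R) (`[0, 1]%classic : set R)
    (fun x => (`|f x - g x| `^ p)%:E) (cst 0%E).
  apply/(ae_eq_integral_abs (@lebesgue_measure R) mD mfg).
  rewrite -[RHS]I0; apply: eq_integral => x _.
  by rewrite gee0_abs// lee_fin powR_ge0.
pose N := [set x : R | 0 <= x <= 1 /\ f x != g x].
have NN : (@lebesgue_measure R).-negligible N.
  apply: negligibleS N0 => x /= [x01 fg] /(_ _) H.
  have /H : x \in `[0%R, 1%R] by rewrite in_itv.
  move=> [] /powR_eq0_eq0/normr0_eq0/eqP; rewrite subr_eq0; exact/negP.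
have : (@lebesgue_measure R).-negligible
   (\bigcup_k ([set x : R | N (x + k%:R)] `|` [set x : R | N (x + - k%:R)])).
  by apply: negligible_bigcup => k; apply: negligibleU; exact: negligible_translation.
apply: negligibleS => x /= fg.
have {}fg : f x != g x by apply/eqP => fgx; apply: fg.
have /andP[h1 h2] := floor_itvD1 x.
have Nx : N (x - (Num.floor x)%:~R).
  split; first by apply/andP; split; lra.
  by rewrite !periodic1_int.
case E : (Num.floor x) Nx => [n|n] Nx; first by exists n => //; right; rewrite /= pmulrn.
by exists n.+1 => //; left; move: Nx; rewrite NegzE rmorphN/= opprK -pmulrn.
Qed.

Lemma measurable_horner (R : realType) (P : {poly R}) :
  measurable_fun setT (fun x : R => P.[x]).
Proof.
rewrite (_ : (fun x => P.[x]) = fun x => \sum_(i < size P) P`_i * x ^+ i).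
  by apply: measurable_sum => i; apply: measurable_funM => //; exact: measurable_funX.
by apply/funext => x; rewrite horner_coef.
Qed.

Lemma in_Tp_ae_eq (R : realType) (p : R) (f g : R -> R) (a x0 : R) :
  measurable_fun setT f -> measurable_fun setT g ->
  ae_eq (@lebesgue_measure R) setT f g -> in_Tp p f a x0 -> in_Tp p g a x0.
Proof.
move=> mf mg fg [C [P [r0 [C0 hP r00 H]]]]; exists C, P, r0.
split; [exact: C0|exact: hP|exact: r00|move=> r rp rr].
have := H r rp rr.
have mP := measurable_horner P.
have E : (\int[@lebesgue_measure R]_(x in ball x0 r) (`|f x - P.[x]| `^ p)%:E =
   \int[@lebesgue_measure R]_(x in ball x0 r) (`|g x - P.[x]| `^ p)%:E)%E.
  apply: ae_eq_integral.
  - exact: measurable_ball.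
  - by apply: measurable_norm_powRe; apply: measurable_funTS; exact: measurable_funB.
  - by apply: measurable_norm_powRe; apply: measurable_funTS; exact: measurable_funB.
  by apply: filterS fg => x /= fgx _; rewrite fgx.
by rewrite E.
Qed.

Lemma Tp_exponent_ae_eq (R : realType) (p : R) (f g : R -> R) (x0 : R) :
  measurable_fun setT f -> measurable_fun setT g ->
  ae_eq (@lebesgue_measure R) setT f g -> Tp_exponent p f x0 = Tp_exponent p g x0.
Proof.
move=> mf mg fg; have gf := ae_eq_sym fg.
apply: le_anti; apply/andP; split; apply: ereal_sup_le => _ [a [pa Ha] <-].
  by exists a; [split; [exact: pa|exact: (in_Tp_ae_eq mf mg fg Ha)]|].
by exists a; [split; [exact: pa|exact: (in_Tp_ae_eq mg mf gf Ha)]|].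
Qed.

(** * Pairing with a block of wavelets *)

Definition bounded_measurable (R : realType) (f : R -> R) : Prop :=
  measurable_fun setT f /\ exists B, forall x, `|f x| <= B.

Lemma bounded_measurableM (R : realType) (f g : R -> R) :
  bounded_measurable f -> bounded_measurable g ->
  bounded_measurable (fun x => f x * g x).
Proof.
move=> [mf [B fB]] [mg [B' gB]]; split; first exact: measurable_funM.
by exists (B * B') => x; rewrite normrM ler_pM.
Qed.

Lemma bounded_measurable_sum (R : realType) (n : nat) (f : nat -> R -> R) :
  (forall i, (i < n)%N -> bounded_measurable (f i)) ->
  bounded_measurable (fun x => \sum_(i < n) f i x).
Proof.
elim: n => [_|n IH H].
  split; first by under eq_fun do rewrite big_ord0; exact: measurable_cst.
  by exists 0 => x; rewrite big_ord0 normr0.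
have [mf [B fB]] := IH (fun i ni => H i (ltnW ni)); have [mn [B' nB]] := H n (leqnn _).
split; first by under eq_fun do rewrite big_ord_recr/=; exact: measurable_funD.
exists (B + B') => x; rewrite big_ord_recr/=; apply: (le_trans (ler_normD _ _)).
exact: lerD.
Qed.

Lemma bounded_measurable_cst (R : realType) (r : R) : bounded_measurable (fun=> r).
Proof. by split; [exact: measurable_cst|exists `|r|]. Qed.

Lemma bounded_measurable_integrable (R : realType) (f : R -> R) :
  bounded_measurable f ->
  (@lebesgue_measure R).-integrable `[0, 1]%classic (EFin \o f).
Proof.
move=> [mf [B fB]]; apply: measurable_bounded_integrable.
- exact: measurable_itv.
- by rewrite /= lebesgue_measure_itv/= lte_fin ltr01 sube0 ltry.
- exact: measurable_funTS.
- exists B; split; first exact: num_real.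
  by move=> x Bx y _; apply: le_trans (ltW Bx).
Qed.

Lemma inner01C (R : realType) (f g : R -> R) : inner01 f g = inner01 g f.
Proof. by apply: eq_Rintegral => x _; rewrite mulrC. Qed.

Lemma inner01Zl (R : realType) (f g : R -> R) (r : R) :
  bounded_measurable f -> bounded_measurable g ->
  inner01 (fun x => r * f x) g = r * inner01 f g.
Proof.
move=> bf bg; rewrite /inner01; under eq_Rintegral do rewrite -mulrA.
rewrite RintegralZl//.
exact/bounded_measurable_integrable/bounded_measurableM.
Qed.

Lemma inner01_suml (R : realType) (n : nat) (f : nat -> R -> R) (g : R -> R) :
  (forall i, (i < n)%N -> bounded_measurable (f i)) -> bounded_measurable g ->
  inner01 (fun x => \sum_(i < n) f i x) g = \sum_(i < n) inner01 (f i) g.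
Proof.
move=> + bg; elim: n => [_|n IH H].
  rewrite big_ord0 /inner01; under eq_Rintegral do rewrite big_ord0 mul0r.
  by rewrite Rintegral_cst ?mul0r//; exact: measurable_itv.
rewrite big_ord_recr/= -IH; last by move=> i ni; apply: H; exact: ltnW.
have bs : bounded_measurable (fun x => \sum_(i < n) f i x).
  by apply: bounded_measurable_sum => i ni; apply: H; exact: ltnW.
have bn := H n (leqnn _).
rewrite /inner01; under eq_Rintegral do rewrite big_ord_recr/= mulrDl.
rewrite RintegralD//.
- exact/bounded_measurable_integrable/bounded_measurableM.
- exact/bounded_measurable_integrable/bounded_measurableM.
Qed.

Section pairing.
Context (R : realType) (psi : R -> R) (theta alpha : R).
Hypothesis hpsi : mother_wavelet psi.
Hypotheses (theta0 : 0 < theta) (theta1 : theta < 1).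
Let spsi : schwartz psi := proj1 hpsi.
Let c := chirp_coef theta alpha.
Let theta01 : 0 <= theta <= 1. Proof. by rewrite !ltW. Qed.

(** A single wavelet is the difference of two blocks. *)
Lemma bounded_measurable_psi_per j k : (k < 2 ^ j)%N ->
  bounded_measurable (psi_per psi j k).
Proof.
move=> kj; split; first exact: (measurable_psi_per spsi).
have [B B0 H] := psi_block_bounded spsi; exists (B + B) => x.
have := H j k.+1 x kj; have := H j k x (ltnW kj).
rewrite /psi_block big_ord_recr/= !ler_norml; lra.
Qed.

Lemma bounded_measurable_psi_block j M : (M <= 2 ^ j)%N ->
  bounded_measurable (psi_block psi j M).
Proof.
by move=> Mj; apply: bounded_measurable_sum => k kM;
  apply: bounded_measurable_psi_per; exact: leq_trans kM Mj.
Qed.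

Lemma inner01_psi_per j k j' k' : (k < 2 ^ j)%N -> (k' < 2 ^ j')%N ->
  inner01 (psi_per psi j k) (psi_per psi j' k') =
  ((j == j') && (k == k'))%:R * (2 ^+ j)^-1.
Proof.
move=> kj kj'; have [_ [_ + _]] := hpsi => /(_ j k j' k' kj kj').
have b := bounded_measurable_psi_per kj; have b' := bounded_measurable_psi_per kj'.
have b'' : bounded_measurable (psi_normalized psi j' k').
  by apply: bounded_measurableM => //; exact: bounded_measurable_cst.
have s0 i : 0 < Num.sqrt (2 ^+ i) :> R by rewrite sqrtr_gt0 exprn_gt0.
rewrite inner01Zl// inner01C inner01Zl// inner01C.
have [->/=|jj] := eqVneq j j'; last first.
  rewrite /= mul0r => /eqP; rewrite !mulf_eq0 !(gt_eqF (s0 _))//= => /eqP.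
  exact.
rewrite mulrA -expr2 sqr_sqrtr ?exprn_ge0// => <-.
by rewrite mulrC mulKf// expf_neq0.
Qed.

Lemma inner01_psi_per_block j k j' : (k < 2 ^ j)%N ->
  inner01 (psi_per psi j k) (chirp_block psi theta j') =
  ((j == j') && (k < 2 ^ (j' - cutoff theta j'))%N)%:R * (2 ^+ j)^-1.
Proof.
move=> kj; set m := (2 ^ (j' - cutoff theta j'))%N.
have mj : (m <= 2 ^ j')%N := pow2_cutoff_le theta j'.
rewrite inner01C /chirp_block /psi_block -/m inner01_suml//; first last.
- exact: bounded_measurable_psi_per.
- by move=> i im; apply: bounded_measurable_psi_per; exact: leq_trans im mj.
rewrite (eq_bigr (fun i : 'I_m => ((j == j') && (k == i))%:R * (2 ^+ j)^-1)); last first.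
  move=> i _; rewrite inner01C inner01_psi_per//.
  exact: leq_trans (ltn_ord i) mj.
rewrite -mulr_suml; congr (_ * _); case: eqVneq => [jj|_]/=; last by rewrite big1.
have [km|km] := ltnP k m.
  rewrite (bigD1 (Ordinal km))//= eqxx big1 ?addr0// => i.
  by rewrite -val_eqE/= eq_sym => /negbTE ->.
rewrite big1// => i _; rewrite (_ : k == i = false)//.
by apply/negbTE; rewrite gtn_eqF// (leq_trans (ltn_ord i)).
Qed.

(** By orthogonality only the coefficients of the block of level j survive: there
    are 2 ^ (j - i) of them, equal to 2 ^ (- alpha j), and each wavelet has squared
    norm 2 ^ (- j). *)
Lemma inner01_partial_sum_block j J : (j < J)%N ->
  inner01 (wavelet_partial_sum psi c J) (chirp_block psi theta j) =
  2 `^ (- alpha * j%:R - (cutoff theta j)%:R).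
Proof.
move=> jJ; have bb : bounded_measurable (chirp_block psi theta j).
  exact/bounded_measurable_psi_block/pow2_cutoff_le.
have bk i k : (k < 2 ^ i)%N -> bounded_measurable (fun x => c i k * psi_per psi i k x).
  move=> ki; apply: bounded_measurableM; first exact: bounded_measurable_cst.
  exact: bounded_measurable_psi_per.
rewrite /wavelet_partial_sum
  (@inner01_suml _ J (fun i x => \sum_(k < 2 ^ i) c i k * psi_per psi i k x))//; last first.
  move=> i _; apply: (@bounded_measurable_sum _ _ (fun k x => c i k * psi_per psi i k x)).
  exact: bk.
rewrite (eq_bigr (fun i : 'I_J => if i == j :> nat then
   2 `^ (- alpha * j%:R - (cutoff theta j)%:R) else 0)).
  rewrite -big_mkcond (bigD1 (Ordinal jJ))//= big1 ?addr0// => i /andP[/eqP ij].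
  by rewrite -val_eqE/= ij eqxx.
move=> i _.
rewrite (@inner01_suml _ _ (fun k x => c i k * psi_per psi i k x))//; last exact: bk.
rewrite (eq_bigr (fun k : 'I_(2 ^ i) => c i k *
   (((i == j :> nat) && (k < 2 ^ (j - cutoff theta j))%N)%:R * (2 ^+ i)^-1))); last first.
  by move=> k _; rewrite inner01Zl// ?inner01_psi_per_block//; exact: bounded_measurable_psi_per.
case: eqVneq => [->|_]/=; last by rewrite big1// => k _; rewrite mul0r mulr0.
transitivity (\sum_(k < 2 ^ j) `|chirp_coef theta alpha j k| `^ 1 * (2 ^+ j)^-1).
  apply: eq_bigr => k _; rewrite /c /chirp_coef; case: ifPn => _.
    by rewrite mul1r powRr1 ?normr_ge0// ger0_norm// powR_ge0.
  by rewrite mul0r normr0 powR0 ?mul0r ?oner_eq0.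
rewrite -mulr_suml sum_chirp_coef// pow2XV -pow2D; congr (2 `^ _); ring.
Qed.
End pairing.

(** * The exponent of the chirp at its singularity and elsewhere *)

Lemma compact_sub_ball (R : realType) (K : set R) : compact K ->
  exists2 r : R, 0 < r & K `<=` ball 0 r.
Proof.
move=> /compact_bounded[M [_ MK]]; exists (`|M| + 2); first by rewrite ltr_wpDl.
move=> x Kx; rewrite /ball/= sub0r normrN.
apply: (@le_lt_trans _ _ (`|M| + 1)); last by rewrite ltrD2l ltr1n.
by apply: MK => //; rewrite (le_lt_trans (ler_norm M))// ltrDl.
Qed.

Lemma cvg_geometric_ereal (R : realType) (C q : R) : 0 < q < 1 ->
  ((C * q ^+ J)%:E) @[J --> \oo] --> (0 : \bar R).
Proof.
move=> /andP[q0 q1]; apply: cvg_EFin; first exact: nearW.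
have : `|q| < 1 by rewrite ger0_norm// ltW.
by move=> /(@cvg_geometric _ C).
Qed.

Lemma integrable01_le (R : realType) (f g : R -> R) (C : R) :
  measurable_fun setT f -> 0 <= C ->
  (@lebesgue_measure R).-integrable `[0, 1]%classic (EFin \o g) ->
  (forall x, `[0, 1]%classic x -> `|f x| <= C * `|g x|) ->
  (@lebesgue_measure R).-integrable `[0, 1]%classic (EFin \o f).
Proof.
move=> mf C0 ig fg.
have mI := measurable_itv `[0, 1] : measurable (`[0, 1]%classic : set (measurableTypeR R)).
have iC := integrableZl mI C ig.
apply: (@le_integrable _ _ R (@lebesgue_measure R) _ mI (EFin \o f) _ _ _ iC).
  by apply/measurable_EFinP; exact: measurable_funTS.
by move=> x Dx /=; rewrite lee_fin normrM (ger0_norm C0); exact: fg.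
Qed.

Lemma integral_indic_le (R : realType) (D A : set R) (g : R -> R) :
  measurable D -> measurable A -> measurable_fun setT g -> (forall x, 0 <= g x) ->
  (\int[@lebesgue_measure R]_(x in D) (g x * \1_A x)%:E <=
   \int[@lebesgue_measure R]_(x in A) (g x)%:E)%E.
Proof.
move=> mD mA mg g0.
have mgA : measurable_fun setT (fun x => (g x * \1_A x)%:E).
  by apply/measurable_EFinP; apply: measurable_funM => //; exact: measurable_indic.
apply: (@le_trans _ _ (\int[@lebesgue_measure R]_x (g x * \1_A x)%:E)%E).
  apply: ge0_subset_integral => // x _; rewrite lee_fin mulr_ge0// indicE ler0n//.
rewrite [leRHS]integral_mkcond le_eqVlt; apply/orP; left; apply/eqP.
apply: eq_integral => x _; rewrite patchE indicE.
by case: ifPn => _; rewrite ?mulr1 ?mulr0.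
Qed.

(** A substitute for the inequality of Hoelder: it bounds an L^1 mean by an L^p
    mean, provided that lam is chosen of the order of the latter. *)
Lemma le_power_sum (R : realType) (lam y p : R) : 0 < lam -> 0 <= y -> 1 <= p ->
  y <= lam + lam `^ (1 - p) * y `^ p.
Proof.
move=> l0 y0 p1; have [yl|ly] := lerP y lam.
  by rewrite (le_trans yl)// lerDl mulr_ge0 ?powR_ge0.
have yp : 0 < y by exact: lt_trans ly.
have e : y `^ (1 - p) * y `^ p = y.
  by rewrite -powRD ?subrK ?powRr1// (gt_eqF yp) implybT.
rewrite -[leLHS]e -[leLHS]add0r lerD ?(ltW l0)// ler_wpM2r ?powR_ge0//.
have -> : 1 - p = - (p - 1) by ring.
by apply: ler_powRN => //; [lra|exact: ltW].
Qed.

Lemma itv01_sub_ball (R : realType) : `[0, 1]%classic `<=` ball (0 : R) 2.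
Proof.
move=> x; rewrite /= in_itv/= => /andP[x0 x1].
by rewrite /ball/= sub0r normrN ger0_norm// (le_lt_trans x1)// ltr1n.
Qed.

(** The estimates of the chirp hold off the integers, which form a null set. *)
Lemma ae_le_dist_int (R : realType) (D : set R) (f g : R -> \bar R) :
  (forall x, 0 < dist_int x -> D x -> (f x <= g x)%E) ->
  {ae @lebesgue_measure R, forall x, D x -> (f x <= g x)%E}.
Proof.
move=> H; apply: negligibleS (@negligible_dist_int_eq0 R) => x /=.
apply: contra_notP => /eqP d0 Dx; apply: H => //.
by rewrite lt_neqAle eq_sym d0 dist_int_ge0.
Qed.

Lemma dist_int_lt01 (R : realType) (x e : R) : 0 <= x <= 1 -> e <= 1 ->
  dist_int x < e -> `|x| < e \/ `|x - 1| < e.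
Proof.
move=> /andP[x0 x1] e1; have [l ->] := dist_intE x => xl.
have l1 : -1 < l.
  by rewrite -(ltr_int R) rmorphN/=; have := ler_norm (x - l%:~R); lra.
have l2 : l < 2.
  by rewrite -(ltr_int R); have := ler_norm (l%:~R - x); rewrite distrC; lra.
have /orP[/eqP l0|/eqP l0] : (l == 0) || (l == 1) by lia.
  by left; rewrite l0 subr0 in xl.
by right; rewrite l0 in xl.
Qed.

Section chirp_exponent.
Context (R : realType) (psi : R -> R) (p h alpha : R).
Hypothesis hpsi : mother_wavelet psi.
Hypotheses (p1 : 1 <= p) (hp : - p^-1 < h) (ha : h < alpha) (an : alpha < 0).
Let spsi : schwartz psi := proj1 hpsi.
Let theta := alpha / h.
Let c := chirp_coef theta alpha.
Let F := chirp_wave psi theta alpha.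
Let p0 : 0 < p. Proof. exact: lt_le_trans p1. Qed.
Let hn : h < 0. Proof. exact: lt_trans an. Qed.
Let theta0 : 0 < theta. Proof. by rewrite /theta nmulr_rgt0// invr_lt0. Qed.
Let theta1 : theta < 1. Proof. by rewrite /theta ltr_ndivrMr// mul1r. Qed.
Let theta01 : 0 <= theta <= 1. Proof. by rewrite !ltW. Qed.
Let alphaE : alpha = theta * h. Proof. by rewrite /theta divfK// lt_eqF. Qed.

Let s_bounds s : - h < s < p^-1 ->
  [/\ 0 <= s <= 1, - alpha < theta * s, 0 < s < 1 & 0 < s * p < 1].
Proof.
move=> /andP[hs sp]; have s0 : 0 < s by apply: lt_trans hs; rewrite oppr_gt0.
have s1 : s < 1 by apply: (lt_le_trans sp); rewrite invf_le1.
split; first by rewrite !ltW.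
- by rewrite {1}alphaE -mulrN ltr_pM2l.
- by rewrite s0.
- by rewrite mulr_gt0//= -ltr_pdivlMr// mul1r.
Qed.

Let s0 : R := (- h + p^-1) / 2.
Let s0_bounds : - h < s0 < p^-1.
Proof. by move: hp; rewrite /s0; lra. Qed.

Lemma measurable_wave : measurable_fun setT F.
Proof.
have [s01 as0 _ _] := s_bounds s0_bounds.
exact: (measurable_chirp_wave spsi theta0 theta1 s01 as0).
Qed.

(** The chirp is dominated by every power of the distance to the integers that is
    slightly worse than h. *)
Lemma wave_le s : - h < s < p^-1 -> exists2 K, 0 < K &
  forall x, `|F x| <= K * dist_int x `^ (- s).
Proof.
move=> /s_bounds[s01 as0 _ _].
have [K [q [K0 q01 H]]] := chirp_wave_rate spsi theta0 theta1 s01 as0.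
exists K => // x; have [d0|d0] := eqVneq (dist_int x) 0.
  by rewrite /F /chirp_wave d0 eqxx normr0 mulr_ge0 ?powR_ge0// ltW.
have dp : 0 < dist_int x by rewrite lt_neqAle eq_sym d0 dist_int_ge0.
have [_ /(_ 0%N)] := H x dp.
by rewrite /wavelet_partial_sum big_ord0 subr0 expr0 mulr1.
Qed.

Lemma powR_wave_le s K x : 0 < K -> `|F x| <= K * dist_int x `^ (- s) ->
  `|F x| `^ p <= K `^ p * dist_int x `^ (- (s * p)).
Proof.
move=> K0 H; rewrite -mulNr powRrM -powRM ?powR_ge0 ?(ltW K0)//.
by rewrite ge0_ler_powR ?nnegrE ?mulr_ge0 ?powR_ge0// ltW.
Qed.

Lemma Lp_loc_wave : Lp_loc p F.
Proof.
split=> [|K cK]; first exact: measurable_wave.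
have [r r0 Kr] := compact_sub_ball cK.
have [_ _ _ sp01] := s_bounds s0_bounds.
have mK := compact_measurable cK.
have [W [mW W0 iW dW]] := dist_int_weight sp01 r0 mK Kr.
have [C C0 H] := wave_le s0_bounds.
apply: (@le_lt_trans _ _ (\int[@lebesgue_measure R]_(x in K) ((C `^ p)%:E * (W x)%:E))%E).
  apply: ge0_le_integral => //=.
  - by apply: measurable_norm_powRe; apply: measurable_funTS; exact: measurable_wave.
  - apply: emeasurable_funM => //.
    by apply/measurable_EFinP/measurable_funTS.
  - move=> x Kx; rewrite -EFinM lee_fin.
    apply: le_trans (powR_wave_le C0 (H x)) _.
    by rewrite ler_wpM2l ?powR_ge0// dW.
rewrite ge0_integralZl_EFin ?powR_ge0//; first last.
- by apply/measurable_EFinP/measurable_funTS.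
- by move=> x _; rewrite lee_fin.
by rewrite lte_mul_pinfty ?lee_fin ?powR_ge0.
Qed.

Lemma chirp_is_wavelet_sum : is_wavelet_sum psi p c F.
Proof.
split; [exact: Lp_loc_wave|exact: (chirp_wave_periodic _ _ spsi)|].
have [s01 as0 _ sp01] := s_bounds s0_bounds.
have [K [q [K0 /andP[q0 q1] H]]] := chirp_wave_rate spsi theta0 theta1 s01 as0.
have mI : measurable (`[0, 1]%classic : set R) by exact: measurable_itv.
have [W [mW W0 iW dW]] := dist_int_weight sp01 (ltr0n R 2) mI (@itv01_sub_ball R).
pose M := fine (\int[@lebesgue_measure R]_(x in `[0%R, 1%R]) (W x)%:E)%E.
have ME : (\int[@lebesgue_measure R]_(x in `[0%R, 1%R]) (W x)%:E)%E = M%:E.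
  rewrite fineK// ge0_fin_numE//; apply: integral_ge0 => x _; by rewrite lee_fin.
have le J : (Lp_int01 p (fun x => (F x - wavelet_partial_sum psi c J x)%R) <=
    (K `^ p * M * (q `^ p) ^+ J)%:E)%E.
  have -> : (K `^ p * M * (q `^ p) ^+ J)%:E =
    (\int[@lebesgue_measure R]_(x in `[0%R, 1%R]) (((K * q ^+ J) `^ p)%:E * (W x)%:E))%E.
    rewrite ge0_integralZl_EFin ?powR_ge0//; first last.
    - by apply/measurable_EFinP/measurable_funTS.
    - by move=> x _; rewrite lee_fin.
    rewrite ME -EFinM powRM ?exprn_ge0 ?(ltW K0) ?(ltW q0)//.
    rewrite -!powR_mulrn ?powR_ge0 ?(ltW q0)// -!powRrM (mulrC p).
    by rewrite mulrAC.
  apply: ae_ge0_le_integral => //=.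
  - apply: measurable_norm_powRe; apply: measurable_funTS; apply: measurable_funB.
      exact: measurable_wave.
    exact: (measurable_partial_sum _ _ spsi).
  - by move=> x _; rewrite mule_ge0// lee_fin// powR_ge0.
  - apply: emeasurable_funM => //; exact/measurable_EFinP/measurable_funTS.
  apply: ae_le_dist_int => x d0 Dx; rewrite -EFinM lee_fin.
  have [_ /(_ J) HJ] := H x d0.
  apply: (@le_trans _ _ ((K * q ^+ J * dist_int x `^ (- s0)) `^ p)).
    by rewrite ge0_ler_powR ?nnegrE ?(ltW p0)//; apply: le_trans HJ.
  rewrite powRM ?powR_ge0 ?mulr_ge0 ?exprn_ge0 ?(ltW K0) ?(ltW q0)//.
  rewrite -powRrM mulNr ler_wpM2l ?powR_ge0//; exact: dW.
apply: (@squeeze_cvge _ _ _ _ (cst 0%E) _ (fun J => (K `^ p * M * (q `^ p) ^+ J)%:E)).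
- by apply: nearW => J; rewrite Lp_int01_ge0 le.
- exact: cvg_cst.
- apply: cvg_geometric_ereal; rewrite powR_gt0//=.
  have := @gt0_ltr_powR R p p0 q 1; rewrite !nnegrE ltW// ler01 powR1; exact.
Qed.

Lemma wave_ball_integral s : - h < s < p^-1 -> exists2 C, 0 < C &
  forall r, 0 < r <= 2^-1 ->
  (\int[@lebesgue_measure R]_(x in ball 0%R r) (`|F x| `^ p)%:E <= (C * r `^ (1 - s * p))%:E)%E.
Proof.
move=> sb; have [_ _ _ sp01] := s_bounds sb.
have [K K0 H] := wave_le sb; have [C C0 HC] := integral_powR_ball_le sp01.
exists (K `^ p * C); first by rewrite mulr_gt0 ?powR_gt0.
move=> r /andP[r0 r2].
rewrite -mulrA EFinM.
apply: le_trans (lee_wpmul2l _ (HC 0 r r0)); last by rewrite lee_fin powR_ge0.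
have mf : measurable_fun (ball (0 : R) r : set R) (fun x : R => (`|x - 0| `^ (- (s * p)))%:E).
  by apply: measurable_norm_powRe; exact: measurable_funB.
rewrite -ge0_integralZl_EFin ?powR_ge0//; try exact: measurable_ball.
apply: ge0_le_integral => //=.
- exact: measurable_ball.
- by apply: measurable_norm_powRe; apply: measurable_funTS; exact: measurable_wave.
- exact: emeasurable_funM.
move=> x; rewrite /ball/= sub0r normrN => xr.
rewrite lee_fin; apply: le_trans (powR_wave_le K0 (H x)) _.
by rewrite subr0 dist_int_small// ltW// (lt_le_trans xr).
Qed.

Lemma in_Tp_wave s : - h < s < p^-1 -> in_Tp p F (- s) 0.
Proof.
move=> sb; have [C C0 H] := wave_ball_integral sb.
exists (C `^ p^-1), 0, 2^-1; split; [exact: powR_gt0|by rewrite eqxx|by rewrite invr_gt0|].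
move=> r r0 r2.
under eq_integral do rewrite horner0 subr0.
have r0' : 0 <= r^-1 by rewrite invr_ge0 ltW.
apply: (@le_trans _ _ (((r^-1)%:E * (C * r `^ (1 - s * p))%:E) `^ p^-1)%E).
  apply: gt0_ler_poweR.
  - by rewrite invr_ge0 ltW.
  - rewrite in_itv/= leey andbT mule_ge0// ?lee_fin//.
    by apply: integral_ge0 => x _; rewrite lee_fin powR_ge0.
  - by rewrite in_itv/= leey andbT -EFinM lee_fin !mulr_ge0 ?powR_ge0// ltW.
  - by rewrite lee_pmul2l ?lte_fin ?invr_gt0// H// r0.
rewrite -EFinM poweR_EFin lee_fin mulrCA powRM ?mulr_ge0 ?powR_ge0 ?(ltW C0)//.
rewrite -(powR_inv1 (ltW r0)) -powRD; last by rewrite (gt_eqF r0) implybT.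
rewrite -powRrM (_ : (-1 + (1 - s * p)) * p^-1 = - s)//.
by field; rewrite gt_eqF.
Qed.

Lemma Tp_exponent_ge : (h%:E <= Tp_exponent p F 0)%E.
Proof.
apply/lee_addgt0Pr => e e0.
pose s := - h + Num.min e (p^-1 + h) / 2.
have g0 : 0 < p^-1 + h by move: hp; lra.
have m0 : 0 < Num.min e (p^-1 + h) by rewrite lt_min e0.
have me : Num.min e (p^-1 + h) <= e by rewrite ge_min lexx.
have mp : Num.min e (p^-1 + h) <= p^-1 + h by rewrite ge_min lexx orbT.
have sb : - h < s < p^-1 by rewrite /s; apply/andP; split; lra.
apply: (@le_trans _ _ ((- s)%:E + e%:E)%E).
  by rewrite -EFinD lee_fin /s; lra.
rewrite leeD2r//; apply: ereal_sup_ubound; exists (- s) => //; split.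
  by rewrite lerN2; case/andP : sb => _ /ltW.
exact: in_Tp_wave.
Qed.

(** The chirp is bounded near a point that is not an integer. *)
Lemma in_Tp_wave_nonint x0 : 0 < dist_int x0 -> in_Tp p F 0 x0.
Proof.
move=> d0; have [K K0 H] := wave_le s0_bounds.
pose B := K * (dist_int x0 / 2) `^ (- s0).
have dd : 0 < dist_int x0 / 2 by rewrite divr_gt0.
have B0 : 0 < B by rewrite mulr_gt0 ?powR_gt0.
exists ((B `^ p * 2) `^ p^-1), 0, (dist_int x0 / 2); split => //.
- by rewrite powR_gt0 ?mulr_gt0 ?powR_gt0.
- by rewrite eqxx.
move=> r r0 rd.
under eq_integral do rewrite horner0 subr0.
have FB x : ball x0 r x -> `|F x| <= B.
  rewrite /ball/= => xr; apply: (le_trans (H x)); rewrite ler_pM2l//.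
  apply: ler_powRN => //; first by have [/andP[]] := s_bounds s0_bounds.
  have [l ->] := dist_intE x; have := dist_int_le x0 l.
  have := ler_distD x x0 (l%:~R); move: xr rd; lra.
rewrite powRr0 mulr1 -poweR_EFin.
have I0 : (0 <= \int[@lebesgue_measure R]_(x in ball x0 r) (`|F x| `^ p)%:E)%E.
  by apply: integral_ge0 => x _; rewrite lee_fin powR_ge0.
apply: gt0_ler_poweR.
- by rewrite invr_ge0 ltW.
- by rewrite in_itv/= leey andbT mule_ge0// lee_fin invr_ge0 ltW.
- by rewrite in_itv/= leey andbT lee_fin mulr_ge0 ?powR_ge0.
rewrite lee_pdivrMl//.
apply: (@le_trans _ _
  (\int[@lebesgue_measure R]_(x in ball x0 r) (cst (B `^ p)%:E x))%E).
  apply: ge0_le_integral => //=.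
  - exact: measurable_ball.
  - by apply: measurable_norm_powRe; apply: measurable_funTS; exact: measurable_wave.
  - by move=> x /FB FxB; rewrite lee_fin ge0_ler_powR ?nnegrE// ltW.
rewrite integral_cst; last exact: measurable_ball.
rewrite [X in (_ * X)%E](lebesgue_measure_ball x0 (ltW r0)) -!EFinM lee_fin.
by rewrite (_ : B `^ p * (r *+ 2) = r * (B `^ p * 2)); [exact: lexx|ring].
Qed.

Lemma Tp_exponent_nonint x0 : 0 < dist_int x0 -> (0 <= Tp_exponent p F x0)%E.
Proof.
move=> d0; apply: ereal_sup_ubound; exists 0 => //; split.
  by rewrite oppr_le0 invr_ge0 ltW.
exact: in_Tp_wave_nonint.
Qed.

Let wave_weight : exists W : R -> R, [/\ measurable_fun setT W, forall x, 0 <= W x,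
  (@lebesgue_measure R).-integrable `[0, 1]%classic (EFin \o W) &
    forall x, `[0, 1]%classic x -> dist_int x `^ (- s0) <= W x].
Proof.
have [_ _ s01 _] := s_bounds s0_bounds.
have mI : measurable (`[0, 1]%classic : set R) by exact: measurable_itv.
have [W [mW W0 iW dW]] := dist_int_weight s01 (ltr0n R 2) mI (@itv01_sub_ball R).
exists W; split=> //; apply/integrableP; split.
  by apply/measurable_EFinP; exact: measurable_funTS.
by under eq_integral do rewrite gee0_abs ?lee_fin//.
Qed.

Lemma wave_integrable : (@lebesgue_measure R).-integrable `[0, 1]%classic (EFin \o F).
Proof.
have [W [mW W0 iW dW]] := wave_weight; have [K K0 H] := wave_le s0_bounds.
apply: (integrable01_le measurable_wave (ltW K0) iW) => x Dx.
by apply: (le_trans (H x)); rewrite ler_pM2l// ger0_norm// dW.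
Qed.

Lemma bounded_measurable_block j : bounded_measurable (chirp_block psi theta j).
Proof. exact/(bounded_measurable_psi_block hpsi)/pow2_cutoff_le. Qed.

Lemma wave_block_integrable j : (@lebesgue_measure R).-integrable `[0, 1]%classic
  (EFin \o (fun x => F x * chirp_block psi theta j x)).
Proof.
have [mb [B bB]] := bounded_measurable_block j.
have B0 : 0 <= B by apply: le_trans (bB 0).
apply: (integrable01_le _ B0 wave_integrable) => [|x _].
  by apply: measurable_funM => //; exact: measurable_wave.
by rewrite normrM mulrC ler_wpM2r.
Qed.

Lemma bounded_measurable_partial_sum J : bounded_measurable (wavelet_partial_sum psi c J).
Proof.
have -> : wavelet_partial_sum psi c J =
    (fun x => \sum_(j < J) 2 `^ (- alpha * j%:R) * chirp_block psi theta j x).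
  by apply/funext => x; exact: chirp_partial_sumE.
apply: (@bounded_measurable_sum _ _ (fun j x => 2 `^ (- alpha * j%:R) * chirp_block psi theta j x)).
move=> j _; apply: bounded_measurableM; first exact: bounded_measurable_cst.
exact: bounded_measurable_block.
Qed.

(** The pairing passes to the limit because the partial sums converge in L^1 at
    a geometric rate and the blocks are bounded. *)
Lemma inner01_wave_block j : inner01 F (chirp_block psi theta j) =
  2 `^ (- alpha * j%:R - (cutoff theta j)%:R).
Proof.
set b := chirp_block psi theta j.
have [s01 as0 _ _] := s_bounds s0_bounds.
have [K [q [K0 /andP[q0 q1] H]]] := chirp_wave_rate spsi theta0 theta1 s01 as0.
have [W [mW W0 iW dW]] := wave_weight.
have [mb [B bB]] := bounded_measurable_block j.
have B0 : 0 <= B by apply: le_trans (bB 0).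
have mI : measurable (`[0, 1]%classic : set R) by exact: measurable_itv.
have mI2 := measurable_itv `[0, 1] : measurable (`[0, 1]%classic : set (measurableTypeR R)).
pose M := fine (\int[@lebesgue_measure R]_(x in `[0%R, 1%R]) (W x)%:E)%E.
have ME : (\int[@lebesgue_measure R]_(x in `[0%R, 1%R]) (W x)%:E)%E = M%:E.
  by rewrite fineK//; exact: integrable_fin_num iW.
have le J : (j < J)%N ->
  `|inner01 F b - 2 `^ (- alpha * j%:R - (cutoff theta j)%:R)| <= B * K * M * q ^+ J.
  move=> jJ; rewrite -(inner01_partial_sum_block alpha hpsi theta0 theta1 jJ) -/c -/b.
  have bS := bounded_measurable_partial_sum J.
  have iS : (@lebesgue_measure R).-integrable `[0, 1]%classic
      (EFin \o (fun x => wavelet_partial_sum psi c J x * b x)).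
    apply/bounded_measurable_integrable/bounded_measurableM => //.
    exact: bounded_measurable_block.
  rewrite /inner01 -RintegralB//; last exact: wave_block_integrable.
  rewrite -lee_fin EFin_normr_Rintegral//; last first.
    exact: (integrableB mI2 (wave_block_integrable j) iS).
  have mg : measurable_fun (`[0, 1]%classic : set R)
      (fun x => (F x * b x - wavelet_partial_sum psi c J x * b x)%:E).
    apply/measurable_EFinP; apply: measurable_funTS; apply: measurable_funB.
      by apply: measurable_funM => //; exact: measurable_wave.
    by apply: measurable_funM => //; exact: bS.1.
  apply: (le_trans (le_abse_integral (@lebesgue_measure R) mI2 mg)).
  have -> : (B * K * M * q ^+ J)%:E =
     (\int[@lebesgue_measure R]_(x in `[0%R, 1%R]) ((B * K * q ^+ J)%:E * (W x)%:E))%E.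
    rewrite ge0_integralZl_EFin ?mulr_ge0 ?exprn_ge0 ?(ltW K0) ?(ltW q0)//; first last.
    - by apply/measurable_EFinP/measurable_funTS.
    - by move=> x _; rewrite lee_fin.
    by rewrite ME -EFinM mulrAC.
  apply: ae_ge0_le_integral => //=.
  - exact: (measurableT_comp (@abse_measurable R setT) mg).
  - by move=> x _; rewrite mule_ge0// lee_fin// !mulr_ge0 ?exprn_ge0 ?(ltW K0) ?(ltW q0).
  - by apply: emeasurable_funM => //; exact/measurable_EFinP/measurable_funTS.
  apply: ae_le_dist_int => x d0 Dx; rewrite -EFinM lee_fin -mulrBl normrM.
  have [_ /(_ J) HJ] := H x d0.
  rewrite mulrC -!mulrA; apply: ler_pM => //; rewrite mulrA.
  by apply: (le_trans HJ); rewrite ler_wpM2l ?mulr_ge0 ?exprn_ge0 ?(ltW K0) ?(ltW q0)// dW.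
apply/eqP; rewrite -subr_eq0 -normr_le0.
have q1' : `|q| < 1 by rewrite ger0_norm// ltW.
apply: (cvgr_to_ge (cvg_geometric (B * K * M) q1')).
by exists j.+1 => // J /= jJ; exact: le.
Qed.

Lemma wave_block_far N : exists2 B, 0 < B & forall j x,
  2 * 2 `^ (- (cutoff theta j)%:R) <= dist_int x ->
  `|chirp_block psi theta j x| <= B * 2 `^ (- (j%:R - (cutoff theta j)%:R) * N%:R).
Proof.
have [B B0 H] := psi_block_decay spsi N; exists B => // j x dx.
have e0 := pow2_gt0 (- (cutoff theta j)%:R : R).
set e := 2 `^ (- (cutoff theta j)%:R) in e0 dx *.
have d0 : 0 < 2 * e by rewrite mulr_gt0.
have := H j (2 ^ (j - cutoff theta j))%N x (2 * e) (pow2_cutoff_le theta j) d0.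
have -> : 2 ^+ j * (2 * e / 2) = 2 `^ (j%:R - (cutoff theta j)%:R) :> R.
  by rewrite pow2D -pow2X -/e; field.
rewrite natr_pow2_cutoff// lexx => /(_ isT (fun l => le_trans dx (dist_int_le x l))).
rewrite -[_ ^+ N]powR_mulrn ?powR_ge0// -powRrM -powRN mulNr.
exact.
Qed.

(** A polynomial is bounded near 0, so that it only matters when a > 0, where it
    limits the order of the L^1 mean of F itself to r ^ 0. *)
Lemma in_Tp_ball_integral a : in_Tp p F a 0 -> exists C r1 : R,
  [/\ 0 < C, 0 < r1 <= 1 & forall r, 0 < r <= r1 ->
   (\int[@lebesgue_measure R]_(x in ball 0%R r) (`|F x|)%:E <= (C * r `^ (1 + Num.min a 0))%:E)%E].
Proof.
move=> [C [P [r0 [C0 _ r00 H]]]].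
pose K := \sum_(i < size P) `|P`_i|.
have K0 : 0 <= K by apply: sumr_ge0.
have PK x : `|x| <= 1 -> `|P.[x]| <= K.
  move=> x1; rewrite horner_coef; apply: (le_trans (ler_norm_sum _ _ _)).
  by apply: ler_sum => i _; rewrite normrM normrX ler_piMr// exprn_ile1.
exists (2 + C `^ p + 2 * K), (Num.min r0 1).
split.
- by rewrite -addrA ltr_wpDr// addr_ge0 ?powR_ge0 ?mulr_ge0.
- by rewrite lt_min r00 ltr01 ge_min lexx orbT.
move=> r /andP[rp]; rewrite le_min => /andP[rr0 r1].
have {H} := H r rp rr0; set I := (\int[_]_(_ in _) _)%E => HI.
have I0 : (0 <= I)%E by apply: integral_ge0 => x _; rewrite lee_fin powR_ge0.
have ra0 : 0 < r `^ a by exact: powR_gt0.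
have {}HI : (I <= (r * (C * r `^ a) `^ p)%:E)%E.
  rewrite EFinM -lee_pdivrMl//.
  have X0 : (0 <= (r^-1)%:E * I)%E by rewrite mule_ge0// lee_fin invr_ge0 ltW.
  have -> : ((r^-1)%:E * I = ((r^-1)%:E * I) `^ p^-1 `^ p)%E.
    by rewrite -poweRrM mulVf ?gt_eqF// poweRe1.
  rewrite -poweR_EFin; apply: gt0_ler_poweR => //.
  - exact: ltW.
  - by rewrite in_itv/= leey andbT poweR_ge0.
  - by rewrite in_itv/= leey andbT lee_fin mulr_ge0 ?powR_ge0// ltW.
have mB : measurable (ball (0 : R) r : set R) by exact: measurable_ball.
have mFP : measurable_fun (ball (0 : R) r : set R) (fun x => (`|F x - P.[x]| `^ p)%:E).
  apply: measurable_norm_powRe; apply: measurable_funTS; apply: measurable_funB => //.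
    exact: measurable_wave.
  exact: measurable_horner.
(* r ^ a is the order of the L^p mean of F - P on the ball: with this threshold
   both terms of le_power_sum integrate to the order r ^ (1 + a) *)
pose w := r `^ a; pose v := w `^ (1 - p).
apply: (@le_trans _ _ (\int[@lebesgue_measure R]_(x in ball 0%R r)
   ((w + K)%:E + v%:E * (`|F x - P.[x]| `^ p)%:E))%E).
  apply: ge0_le_integral => //=.
  - apply/measurable_EFinP; apply: measurable_funTS.
    by apply: (measurableT_comp (@normr_measurable _ _)); exact: measurable_wave.
  - by apply: emeasurable_funD => //; exact: emeasurable_funM.
  move=> x; rewrite /ball/= sub0r normrN => xr.
  rewrite lee_fin.
  have := @le_power_sum R w `|F x - P.[x]| p ra0 (normr_ge0 _) p1.
  have := PK x (ltW (lt_le_trans xr r1)).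
  have := lerB_normD (F x) (- P.[x]); rewrite normrN -/v.
  have := ler_normB (F x) P.[x]; have := lerB_dist (F x) P.[x].
  lra.
rewrite ge0_integralD//=; first last.
- by apply: emeasurable_funM.
- by move=> x _; rewrite mule_ge0// lee_fin powR_ge0.
- by move=> x _; rewrite lee_fin addr_ge0// ltW.
rewrite ge0_integralZl_EFin ?powR_ge0// integral_cst//.
rewrite [X in (_ * X + _)%E](lebesgue_measure_ball 0 (ltW rp)).
apply: (@le_trans _ _ (((w + K) * (r *+ 2))%:E + (v * (r * (C * w) `^ p))%:E)%E).
  by rewrite -EFinM leeD2l// [leRHS]EFinM lee_wpmul2l// lee_fin powR_ge0.
rewrite -EFinD lee_fin.
have -> : v * (r * (C * w) `^ p) = C `^ p * (w * r).
  rewrite powRM ?(ltW C0) ?(ltW ra0)// /v.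
  have e : w `^ (1 - p) * w `^ p = w.
    by rewrite -powRD ?subrK ?powRr1 ?(ltW ra0)// (gt_eqF ra0) implybT.
  by rewrite -[in RHS]e; ring.
have wr : w * r <= r `^ (1 + Num.min a 0).
  rewrite -[r in w * r](powRr1 (ltW rp)) -powRD ?(gt_eqF rp) ?implybT//.
  rewrite (addrC a); apply: ger_powR; first by rewrite rp.
  by rewrite lerD2l ge_min lexx.
have rr : r <= r `^ (1 + Num.min a 0).
  rewrite -[r in leLHS](powRr1 (ltW rp)).
  apply: ger_powR; first by rewrite rp.
  by rewrite gerDl ge_min lexx orbT.
have := ler_wpM2l K0 rr; have := ler_wpM2l (powR_ge0 C p) wr.
rewrite mulr2n; nra.
Qed.

Let mnF : measurable_fun setT (fun x => `|F x|).
Proof.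
apply: (measurableT_comp (@normr_measurable _ _)).
exact: measurable_wave.
Qed.

Lemma wave_ball1 (r : R) : (\int[@lebesgue_measure R]_(x in ball (1 : R)%R r) (`|F x|)%:E =
  \int[@lebesgue_measure R]_(x in ball 0%R r) (`|F x|)%:E)%E.
Proof.
have mE : measurable_fun (ball (1 : R) r : set R) (fun x => (`|F x|)%:E).
  by apply/measurable_EFinP; exact: measurable_funTS.
have F0 x : (ball (1 : R) r : set R) x -> (0 <= (`|F x|)%:E)%E by rewrite lee_fin.
have e := @ge0_integral_translation R 1 (ball (1 : R) r) (fun x => (`|F x|)%:E)
  (measurable_ball _ _) mE F0.
have B0 : [set x : R | ball (1 : R) r (x + 1)] = ball (0 : R) r.
  by apply/seteqP; split => x; rewrite /ball/= opprD addrCA subrr addr0 sub0r.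
rewrite B0 in e; rewrite e.
by apply: eq_integral => x _; rewrite /F (chirp_wave_periodic _ _ spsi).
Qed.

(** The pairing of the chirp with its block of level j sees the chirp on the balls
    of radius twice the length of the block, where regularity at 0 bounds it, and
    elsewhere only through the rapidly decreasing tail of the block. *)
Lemma wave_block_pairing_le (a : R) (N : nat) : in_Tp p F a 0 ->
  exists A1 A2 r1 : R, [/\ 0 < A1, 0 < A2, 0 < r1 & forall j,
   2 * 2 `^ (- (cutoff theta j)%:R) <= r1 ->
   2 `^ (- alpha * j%:R - (cutoff theta j)%:R) <=
     A1 * 2 `^ ((1 - (cutoff theta j)%:R) * (1 + Num.min a 0)) +
     A2 * 2 `^ (- (j%:R - (cutoff theta j)%:R) * N%:R)].
Proof.
move=> /in_Tp_ball_integral[C [r1 [C0 /andP[r10 r11] H]]].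
have [B B0 HB] := psi_block_bounded spsi.
have [BN BN0 HN] := wave_block_far N.
have mI : measurable (`[0, 1]%classic : set R) by exact: measurable_itv.
have mI2 := measurable_itv `[0, 1] : measurable (`[0, 1]%classic : set (measurableTypeR R)).
have iF := wave_integrable.
pose M := fine (\int[@lebesgue_measure R]_(x in `[0%R, 1%R]) `|F x|%:E)%E.
have ME : (\int[@lebesgue_measure R]_(x in `[0%R, 1%R]) `|F x|%:E)%E = M%:E.
  rewrite fineK// ge0_fin_numE; last by apply: integral_ge0 => x _; rewrite lee_fin.
  by have /integrableP[_] := iF.
have M0 : 0 <= M by rewrite -lee_fin -ME; apply: integral_ge0 => x _; rewrite lee_fin.
exists (2 * B * C), (BN * (M + 1)), (Num.min r1 2^-1); split.
- by rewrite !mulr_gt0.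
- by rewrite mulr_gt0// ltr_wpDl.
- by rewrite lt_min r10 invr_gt0 ltr0n.
move=> j; set e := 2 `^ (- (cutoff theta j)%:R); rewrite le_min => /andP[er1 er2].
set E := 2 `^ (- (_ - _) * _).
have E0 : 0 < E := pow2_gt0 _.
have e0 : 0 < e := pow2_gt0 _.
have -> : 2 `^ ((1 - (cutoff theta j)%:R) * (1 + Num.min a 0)) = (2 * e) `^ (1 + Num.min a 0).
  by rewrite powRrM pow2D powRr1.
rewrite -inner01_wave_block.
set b := chirp_block psi _ j.
have mFb : measurable_fun (`[0, 1]%classic : set R) (fun x => (F x * b x)%:E).
  by have /integrableP[] := wave_block_integrable j.
apply: le_trans (ler_norm _) _; rewrite -lee_fin.
rewrite EFin_normr_Rintegral//; last exact: (wave_block_integrable j).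
apply: (le_trans (le_abse_integral (@lebesgue_measure R) mI2 mFb)).
pose g (z x : R) := `|F x| * \1_(ball z (2 * e)) x.
have g0 z x : 0 <= g z x by rewrite mulr_ge0// indicE.
have mg z : measurable_fun setT (g z).
  by apply: measurable_funM => //; apply: measurable_indic; exact: measurable_ball.
have mE (u : R -> R) : measurable_fun setT u ->
    measurable_fun (`[0, 1]%classic : set R) (EFin \o u).
  by move=> mu; apply/measurable_EFinP; exact: measurable_funTS.
(* the block is bounded near 0 and 1, and negligible in between *)
apply: (@le_trans _ _ (\int[@lebesgue_measure R]_(x in `[0%R, 1%R])
   (B%:E * ((g 0 x)%:E + (g 1 x)%:E) + (BN * E)%:E * (`|F x|)%:E))%E).
  apply: ge0_le_integral => //=.
  - exact: (measurableT_comp (@abse_measurable R setT) mFb).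
  - by apply: emeasurable_funD; apply: emeasurable_funM => //;
      [apply: emeasurable_funD|]; exact: mE.
  move=> x; rewrite in_itv/= => /andP[x0 x1]; rewrite lee_fin normrM.
  have Fx0 : 0 <= `|F x| := normr_ge0 _.
  have [dx|dx] := lerP (2 * e) (dist_int x).
    apply: (@le_trans _ _ (BN * E * `|F x|)); last first.
      by rewrite lerDr mulr_ge0 ?addr_ge0 ?(ltW B0).
    by rewrite mulrC ler_wpM2r//; exact: HN.
  have bB : `|b x| <= B by apply: HB; exact: pow2_cutoff_le.
  apply: (@le_trans _ _ (B * `|F x|)); first by rewrite mulrC ler_wpM2r.
  apply: (@le_trans _ _ (B * (g 0 x + g 1 x))); last first.
    by rewrite lerDl !mulr_ge0 ?(ltW BN0) ?(ltW E0).
  rewrite ler_pM2l//.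
  have x01 : 0 <= x <= 1 by rewrite x0.
  have e1 : 2 * e <= 1 by apply: (le_trans er2); rewrite invf_le1// ler1n.
  have [xe|xe] := dist_int_lt01 x01 e1 dx.
    rewrite -[leLHS]addr0 lerD// /g indicE mem_set ?mulr1//.
    by rewrite /ball/= sub0r normrN.
  rewrite -[leLHS]add0r lerD// /g indicE mem_set ?mulr1//.
  by rewrite /ball/= distrC.
rewrite ge0_integralD//=; first last.
- by apply: emeasurable_funM => //; exact: mE.
- by move=> x _; rewrite lee_fin mulr_ge0// mulr_ge0// ltW.
- by apply: emeasurable_funM => //; apply: emeasurable_funD; exact: mE.
- by move=> x _; rewrite lee_fin mulr_ge0 ?addr_ge0// ltW.
rewrite ge0_integralZl_EFin ?(ltW B0)//; first last.
- by apply: emeasurable_funD; exact: mE.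
- by move=> x _; rewrite lee_fin addr_ge0.
rewrite ge0_integralD//=; first last.
- exact: mE.
- by move=> x _; rewrite lee_fin.
- exact: mE.
- by move=> x _; rewrite lee_fin.
rewrite ge0_integralZl_EFin ?mulr_ge0 ?(ltW BN0) ?(ltW E0)//; last exact: mE.
rewrite ME.
have Hb : 0 < 2 * e <= r1 by rewrite mulr_gt0.
have ge z : (\int[@lebesgue_measure R]_(x in ball z (2 * e)) (`|F x|)%:E <=
     (C * (2 * e) `^ (1 + Num.min a 0))%:E)%E ->
   (\int[@lebesgue_measure R]_(x in `[0%R, 1%R]) (g z x)%:E <=
     (C * (2 * e) `^ (1 + Num.min a 0))%:E)%E.
  by apply: le_trans; apply: integral_indic_le => //; exact: measurable_ball.
apply: (@le_trans _ _ (B%:E * ((C * (2 * e) `^ (1 + Num.min a 0))%:E +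
    (C * (2 * e) `^ (1 + Num.min a 0))%:E) + (BN * E)%:E * M%:E)%E).
  apply: leeD => //; apply: lee_wpmul2l; first by rewrite lee_fin ltW.
  by apply: leeD; apply: ge; rewrite ?wave_ball1; exact: H.
set X := C * (2 * e) `^ (1 + Num.min a 0).
change ((B * (X + X) + BN * E * M)%:E <=
  (2 * B * C * (2 * e) `^ (1 + Num.min a 0) + BN * (M + 1) * E)%:E)%E.
rewrite lee_fin /X.
have : 0 <= BN * E by rewrite mulr_ge0// ltW.
lra.
Qed.

(** The pairing equals 2 ^ (- alpha j - i), where 2 ^ (- i) is the length of the
    block and 2 ^ (- alpha j) is of the order of (2 ^ (- i)) ^ h. If the chirp were
    more regular than h at 0, the two bounds of wave_block_pairing_le would be
    smaller by a factor that tends to 0 as j grows. *)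
Lemma in_Tp_wave_le a : in_Tp p F a 0 -> a <= h.
Proof.
move=> Ha; rewrite leNgt; apply/negP => ha'.
pose beta := Num.min a 0.
have hb : h < beta by rewrite lt_min ha' hn.
(* with this N the power of the far term is at most 2 ^ (- j) times the left-hand
   side, since j - i >= (1 - theta) j *)
pose N := (Num.bound (2 / (1 - theta))).
have N2 : 2 <= (1 - theta) * N%:R.
  rewrite mulrC -ler_pdivrMr ?subr_gt0// ltW//; apply: archi_boundP.
  by rewrite divr_ge0// subr_ge0 ltW.
have [A1 [A2 [r1 [A10 A20 r10 H]]]] := wave_block_pairing_le N Ha.
pose K1 := 1 + beta + beta - h.
have [k2 k2E] : exists k, A1 * 2 `^ K1 + A2 = 2 `^ k.
  by apply: exists_log2; rewrite addr_gt0// mulr_gt0 ?pow2_gt0.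
have [k1 k1E] := exists_log2 r10.
(* up to constants, the near term and the far term gain the factors
   2 ^ (- theta (beta - h) j) and 2 ^ (- j) over the left-hand side *)
pose delta := Num.min (theta * (beta - h)) 1.
have delta0 : 0 < delta by rewrite lt_min ltr01 mulr_gt0// subr_gt0.
near \oo => j.
have j1 : (2 - k1) / theta <= j%:R by near: j; exact: nbhs_infty_ger.
have j2 : (`|k2| + 1) / delta <= j%:R by near: j; exact: nbhs_infty_ger.
have /andP[i1 i2] := cutoff_itv j (ltW theta0).
have ij : (cutoff theta j)%:R <= j%:R :> R by rewrite ler_nat cutoff_le// !ltW.
have := H j; set i := (cutoff theta j)%:R in i1 i2 ij *.
move: j1 j2; rewrite !ler_pdivrMr// ![j%:R * _]mulrC => j1 j2.
rewrite k1E -[X in X * _ <= _](powRr1 (ler0n _ 2)) -pow2D ler_pow2.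
have -> : 1 + - i <= k1 by lra.
move=> /(_ isT) main.
have a1 : 2 `^ ((1 - i) * (1 + beta)) <=
    2 `^ (- alpha * j%:R - i) * (2 `^ K1 * 2 `^ (- delta * j%:R)).
  rewrite -!pow2D ler_pow2.
  have : delta * j%:R <= theta * (beta - h) * j%:R by rewrite ler_wpM2r// ge_min lexx.
  have : (theta * j%:R - 1) * (beta - h) <= i * (beta - h).
    by rewrite ler_pM2r ?subr_gt0// ltW// ltrBlDr.
  have : h * (theta * j%:R) <= h * i by rewrite ler_nM2l.
  rewrite /K1 alphaE; lra.
have a2 : 2 `^ (- (j%:R - i) * N%:R) <= 2 `^ (- alpha * j%:R - i) * 2 `^ (- delta * j%:R).
  rewrite -!pow2D ler_pow2.
  have : delta * j%:R <= 1 * j%:R by rewrite ler_wpM2r// ge_min lexx orbT.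
  have : (1 - theta) * j%:R * N%:R <= (j%:R - i) * N%:R by rewrite ler_wpM2r//; lra.
  have : 2 * j%:R <= (1 - theta) * N%:R * j%:R by rewrite ler_wpM2r.
  have : 0 <= - alpha * j%:R by rewrite mulr_ge0// oppr_ge0 ltW.
  lra.
have T0 := pow2_gt0 (- alpha * j%:R - i).
set T := 2 `^ (- alpha * j%:R - i) in main a1 a2 T0.
have : T * 1 <= T * (2 `^ k2 * 2 `^ (- delta * j%:R)).
  rewrite -k2E mulr1; apply: (le_trans main).
  have := ler_wpM2l (ltW A10) a1; have := ler_wpM2l (ltW A20) a2.
  rewrite -/beta; lra.
rewrite ler_pM2l// -pow2D -[leLHS](powRr0 2) ler_pow2.
by apply/negP; rewrite -ltNge; have := ler_norm k2; lra.
Unshelve. all: by end_near. Qed.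

Lemma Tp_exponent_wave0 : Tp_exponent p F 0 = h%:E.
Proof.
apply/eqP; rewrite eq_le Tp_exponent_ge// andbT.
by apply: ge_ereal_sup => _ [a [_ /in_Tp_wave_le ah] <-]; rewrite lee_fin.
Qed.
End chirp_exponent.

(** * The spectrum of the chirp *)

Lemma p_exponent_ge1 (R : realType) (psi : R -> R) (p h alpha x : R) :
  mother_wavelet psi -> 1 <= p -> - p^-1 < h -> h < alpha -> alpha < 0 ->
  p_exponent psi p (chirp_coef (alpha / h) alpha) x =
  Tp_exponent p (chirp_wave psi (alpha / h) alpha) x.
Proof.
move=> hpsi p1 hp ha an; rewrite /p_exponent p1.
set c := chirp_coef _ _; set F := chirp_wave _ _ _.
have FS : is_wavelet_sum psi p c F := chirp_is_wavelet_sum hpsi p1 hp ha an.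
have fS : is_wavelet_sum psi p c (wavelet_sum psi p c).
  exact: (@xgetPex _ _ [set f | is_wavelet_sum psi p c f] (ex_intro _ F FS)).
set f := wavelet_sum psi p c in fS *.
have mS J : measurable_fun setT (wavelet_partial_sum psi c J).
  exact: (measurable_partial_sum _ _ hpsi.1).
have p0 : 0 < p by exact: lt_le_trans p1.
have mF : measurable_fun setT F by have [[]] := FS.
have mf : measurable_fun setT f by have [[]] := fS.
exact: Tp_exponent_ae_eq mf mF (is_wavelet_sum_unique p0 mS fS FS).
Qed.

Lemma p_exponent_chirp0 (R : realType) (psi : R -> R) (p h alpha : R) :
  mother_wavelet psi -> 0 < p -> - p^-1 < h -> h < alpha -> alpha < 0 ->
  p_exponent psi p (chirp_coef (alpha / h) alpha) 0 = h%:E.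
Proof.
move=> hpsi p0 hp ha an; have [p1|p1] := lerP 1 p.
  by rewrite p_exponent_ge1// Tp_exponent_wave0.
rewrite /p_exponent (lt_geF p1); apply: leader_exponent_chirp0 => //.
exact: lt_trans an.
Qed.

Lemma p_exponent_chirp_nonint (R : realType) (psi : R -> R) (p h alpha x : R) :
  mother_wavelet psi -> 0 < p -> - p^-1 < h -> h < alpha -> alpha < 0 ->
  0 < dist_int x ->
  (0 <= p_exponent psi p (chirp_coef (alpha / h) alpha) x)%E.
Proof.
move=> hpsi p0 hp ha an dx; have [p1|p1] := lerP 1 p.
  by rewrite p_exponent_ge1// Tp_exponent_nonint.
rewrite /p_exponent (lt_geF p1) leader_exponent_chirp_nonint//.
  exact: lt_trans an.
apply/eqP => fx; move: dx; rewrite /dist_int fx subr0.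
by rewrite lt_min ltxx.
Qed.

Theorem proposition1p8 (R : realType) (psi : R -> R) (hpsi : mother_wavelet psi)
    (p h alpha : R) (hp : 0 < p) (hph : - p^-1 < h) (hha : h < alpha)
    (ha : alpha < 0) :
  exists c : nat -> nat -> R,
    [/\ 1 <= p -> exists f : R -> R, is_wavelet_sum psi p c f,
        (0 < scaling_function c p)%E,
        p_spectrum psi p c h =
          ((wavelet_density c alpha - 1) * h%:E / alpha%:E + 1)%E
      & ((wavelet_density c alpha - 1) * h%:E / alpha%:E + 1 >
         (h + p^-1)%:E *
         ereal_sup [set wavelet_density c a / (a + p^-1)%:E
                   | a in `](- p^-1)%R, h]%classic])%E].
Proof.
have hn : h < 0 by exact: lt_trans ha.
have t0 : 0 < alpha / h by rewrite nmulr_rgt0// invr_lt0.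
have t1 : alpha / h < 1 by rewrite ltr_ndivrMr// mul1r.
have t01 : 0 <= alpha / h <= 1 by rewrite !ltW.
have hp1 : 0 < h + p^-1 by move: hph; lra.
set c := chirp_coef (alpha / h) alpha.
have dE : ((wavelet_density c alpha - 1) * h%:E / alpha%:E + 1 = 0)%E.
  rewrite wavelet_density_chirp// inver lt_eqF//.
  change (((1 - alpha / h - 1) * h / alpha + 1)%:E = 0%:E :> \bar R).
  by congr (_%:E); field; rewrite !lt_eqF.
exists c; split.
- move=> p1; exists (chirp_wave psi (alpha / h) alpha).
  exact: chirp_is_wavelet_sum.
- rewrite scaling_function_chirp// lte_fin.
  have -> : alpha / h + alpha * p = alpha / h * p * (h + p^-1).
    by field; rewrite (gt_eqF hp) (lt_eqF hn).
  exact: mulr_gt0 (mulr_gt0 t0 hp) hp1.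
- rewrite dE; apply: hausdorff_dim_countable.
    apply: sub_countable (countable_int R); apply: subset_card_le => x /= xh.
    have [d0|d0] := eqVneq (dist_int x) 0.
      by have [l ->] := dist_int_eq0 d0; exists l.
    have dx : 0 < dist_int x by rewrite lt_neqAle eq_sym d0 dist_int_ge0.
    have := p_exponent_chirp_nonint hpsi hp hph hha ha dx.
    by rewrite -/c xh lee_fin leNgt hn.
  by exists 0; exact: p_exponent_chirp0.
- rewrite dE (_ : [set _ | _ in _] = [set -oo%E]).
    by rewrite ereal_sup1 gt0_muleNy// lte_fin.
  have E a : `](- p^-1)%R, h]%classic a ->
      (wavelet_density c a / (a + p^-1)%:E = -oo)%E.
    rewrite /= in_itv/= => /andP[pa ah].
    have ap : 0 < a + p^-1 by move: pa; lra.
    rewrite wavelet_density_chirp_lt//; last exact: le_lt_trans hha.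
    by rewrite inver gt_eqF// gt0_mulNye// lte_fin invr_gt0.
  apply/seteqP; split=> [_ [a ah <-]|_ ->]; first by rewrite /= E.
  by exists h; [rewrite /= in_itv/= hph lexx|rewrite E//= in_itv/= hph lexx].
Qed.
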